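(* Let $1<\alpha<2$, $\lambda\ge0$, $K\ge0$, and let $u$ be the exact, sufficiently regular solution of $$\frac{\partial u}{\partial t}=K\,{}_xD_b^{\alpha,\lambda}u+f\ \text{ on }(a,b)\times(0,T],\qquad u(x,0)=u_0(x),\quad u(a,t)=u_a(t),\quad u(b,t)=0.$$ Let $h=(b-a)/M$, $\tau=T/N$ with $M,N$ positive integers, $x_i=a+ih$, $t_n=n\tau$, and let $U_i^n$ be the solution of the finite difference scheme $${}_{R}\mathcal{B}U_i^{n+1}-K\tau\,{}_{R}\tilde D_h^{\alpha,\lambda}U_i^{n+1}={}_{R}\mathcal{B}U_i^n+\tau\,{}_{R}\mathcal{B}f_i^{n+1},\quad 1\le i\le M-1,\ 0\le n\le N-1,$$ with $U_i^0=u_0(x_i)$, $U_0^n=u_a(t_n)$, $U_M^n=0$ and $f_i^n=f(x_i,t_n)$. Then, with $u^n=(u(x_i,t_n))_i$, $$\|u^n-U^n\|\le C(\tau+h^3)\qquad\text{for all }1\le n\le N,$$ where $C$ is a constant independent of $n$, $\tau$ and $h$.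
   Context: ${}_xD_b^{\alpha,\lambda}u(x)=\frac{e^{\lambda x}}{\Gamma(2-\alpha)}\frac{d^2}{dx^2}\int_x^b(s-x)^{1-\alpha}e^{-\lambda s}u(s)ds-\lambda^\alpha u(x)+\alpha\lambda^{\alpha-1}u'(x)$. For a grid function $V$: ${}_{R}\mathcal{B}V_i=\frac16e^{\lambda h}V_{i-1}+\frac23V_i+\frac16e^{-\lambda h}V_{i+1}$ and $${}_{R}\tilde D_h^{\alpha,\lambda}V_i=\frac1{h^\alpha}\sum_{k=0}^{M-i+1}w_k^{(\alpha,\lambda)}V_{i+k-1}-\frac{\alpha\lambda^{\alpha-1}}{2h}\left(e^{\lambda h}V_{i-1}-e^{-\lambda h}V_{i+1}\right)+\lambda^\alpha(\alpha-1)\,{}_{R}\mathcal{B}V_i.$$ The weights: let $g_k^{(\alpha)}=\frac{\Gamma(k-\alpha)}{\Gamma(-\alpha)\Gamma(k+1)}$, $\mu_{-1}=\frac1{24}(4-7\alpha+3\alpha^2)$, $\mu_0=\frac1{12}(8+\alpha-3\alpha^2)$, $\mu_1=\frac1{24}(4+5\alpha+3\alpha^2)$. Then $w_0^{(\alpha,\lambda)}=\mu_1g_0^{(\alpha)}e^{\lambda h}$, $w_1^{(\alpha,\lambda)}=\mu_1g_1^{(\alpha)}+\mu_0g_0^{(\alpha)}$, and $w_k^{(\alpha,\lambda)}=(\mu_1g_k^{(\alpha)}+\mu_0g_{k-1}^{(\alpha)}+\mu_{-1}g_{k-2}^{(\alpha)})e^{(1-k)\lambda h}$ for $k\ge2$.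 Norm: $\|v\|^2=h\sum_{i=1}^{M-1}v_i^2$. ''Sufficiently regular'' (standing assumption): the solution is unique and smooth enough that the local truncation errors $R_i^{n+1}$, defined by $${}_{R}\mathcal{B}u_i^{n+1}-K\tau\,{}_{R}\tilde D_h^{\alpha,\lambda}u_i^{n+1}={}_{R}\mathcal{B}u_i^n+\tau\,{}_{R}\mathcal{B}f_i^{n+1}+\tau R_i^{n+1},\qquad u_i^n=u(x_i,t_n),$$ satisfy $|R_i^{n+1}|\le C_2(\tau+h^3)$ with $C_2$ independent of $i,n,\tau,h$. *)

(* Defs.v *)
From HB Require Import structures.
From mathcomp Require Import all_boot all_order all_algebra.
From mathcomp Require Import all_classical all_reals all_analysis.
Set Implicit Arguments.
Unset Strict Implicit.
Unset Printing Implicit Defensive.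
Import Order.TTheory GRing.Theory Num.Theory.
Import numFieldNormedType.Exports.
Local Open Scope classical_set_scope.
Local Open Scope ring_scope.

(* Euler's integral; it is only meaningful for 0 < x. *)
Definition Gamma_integral (R : realType) (x : R) : R :=
  \int[@lebesgue_measure R]_(t in `]0, +oo[) (t `^ (x - 1) * expR (- t)).

(* Gamma on the real line, continued to x < 0 by iterating
   Gamma y = Gamma (y + 1) / y until the argument is positive: for a negative
   non-integer x, x + `|floor x| lies in ]0, 1[.  The value at the poles
   0, -1, -2, ... is junk. *)
Definition Gamma (R : realType) (x : R) : R :=
  let n := if 0 < x then 0%N else `|Num.floor x|%N in
  Gamma_integral (x + n%:R) / \prod_(i < n) (x + i%:R).

Definition right_tempered_integral (R : realType) (alpha lambda b : R)
    (v : R -> R) (x : R) : R :=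
  \int[@lebesgue_measure R]_(s in `[x, b])
    ((s - x) `^ (1 - alpha) * expR (- (lambda * s)) * v s).

(* `^ satisfies 0 `^ p = 0 for p != 0, so that the terms with a power of lambda
   vanish when lambda = 0 and 1 < alpha. *)
Definition right_tempered_derivative (R : realType) (alpha lambda b : R)
    (v : R -> R) (x : R) : R :=
  expR (lambda * x) / Gamma (2 - alpha)
    * derive1n 2 (right_tempered_integral alpha lambda b v) x
  - lambda `^ alpha * v x
  + alpha * lambda `^ (alpha - 1) * derive1 v x.

(* Existence and continuity on ]a, b[ of the derivatives occurring in
   right_tempered_derivative, whose definition uses the total operator derive1. *)
Definition tempered_differentiable (R : realType) (alpha lambda a b : R)
    (v : R -> R) : Prop :=
  let J := right_tempered_integral alpha lambda b v in
  [/\ {in `]a, b[, forall x, derivable v x 1},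
      {in `]a, b[, forall x, derivable J x 1},
      {in `]a, b[, forall x, derivable (derive1 J) x 1},
      {in `]a, b[, continuous (derive1 v)} &
      {in `]a, b[, continuous (derive1n 2 J)}].

(* The t-derivative is taken within [0, T], hence one-sided at t = T; the
   convergence states both that it exists and that the equation holds. *)
Definition is_solution (R : realType) (alpha lambda K a b T : R)
    (f : R -> R -> R) (u0 ua : R -> R) (u : R -> R -> R) : Prop :=
  [/\ {within `[a, b] `*` `[0, T], continuous (fun p : R * R => u p.1 p.2)},
      forall t, 0 < t <= T ->
        tempered_differentiable alpha lambda a b (u^~ t),
      forall x t, a < x < b -> 0 < t <= T ->
        (u x s - u x t) / (s - t) @[s --> within `[0, T] t^'] -->
          K * right_tempered_derivative alpha lambda b (u^~ t) x + f x t,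
      forall x, a <= x <= b -> u x 0 = u0 x &
      forall t, 0 <= t <= T -> u a t = ua t /\ u b t = 0].

Definition is_unique_solution (R : realType) (alpha lambda K a b T : R)
    (f : R -> R -> R) (u0 ua : R -> R) (u : R -> R -> R) : Prop :=
  is_solution alpha lambda K a b T f u0 ua u /\
  forall v, is_solution alpha lambda K a b T f u0 ua v ->
    forall x t, a <= x <= b -> 0 <= t <= T -> v x t = u x t.

Definition gweight (R : realType) (alpha : R) (k : nat) : R :=
  Gamma (k%:R - alpha) / (Gamma (- alpha) * Gamma (k%:R + 1)).

Definition mu_m1 (R : realType) (alpha : R) : R :=
  (4 - 7 * alpha + 3 * alpha ^+ 2) / 24.
Definition mu_0 (R : realType) (alpha : R) : R :=
  (8 + alpha - 3 * alpha ^+ 2) / 12.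
Definition mu_1 (R : realType) (alpha : R) : R :=
  (4 + 5 * alpha + 3 * alpha ^+ 2) / 24.

Definition wweight (R : realType) (alpha lambda h : R) (k : nat) : R :=
  match k with
  | 0 => mu_1 alpha * gweight alpha 0 * expR (lambda * h)
  | 1 => mu_1 alpha * gweight alpha 1 + mu_0 alpha * gweight alpha 0
  | k'.+2 => (mu_1 alpha * gweight alpha k + mu_0 alpha * gweight alpha k'.+1
              + mu_m1 alpha * gweight alpha k')
             * expR ((1 - k%:R) * lambda * h)
  end.

(* Grid functions are maps nat -> R of which only the values at 0, ..., M
   matter: the two operators below are used at 1 <= i <= M - 1 only, where the
   truncated subtractions on nat are exact. *)
Definition Bop (R : realType) (lambda h : R) (V : nat -> R) (i : nat) : R :=
  1 / 6 * expR (lambda * h) * V (i - 1)%N + 2 / 3 * V i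
  + 1 / 6 * expR (- (lambda * h)) * V (i + 1)%N.

Definition Dop (R : realType) (alpha lambda h : R) (M : nat)
    (V : nat -> R) (i : nat) : R :=
  1 / h `^ alpha
    * \sum_(0 <= k < (M - i + 1).+1)
        wweight alpha lambda h k * V (i + k - 1)%N
  - alpha * lambda `^ (alpha - 1) / (2 * h)
    * (expR (lambda * h) * V (i - 1)%N - expR (- (lambda * h)) * V (i + 1)%N)
  + lambda `^ alpha * (alpha - 1) * Bop lambda h V i.

Definition xgrid (R : realType) (a b : R) (M i : nat) : R :=
  a + i%:R * ((b - a) / M%:R).
Definition tgrid (R : realType) (T : R) (N n : nat) : R := n%:R * (T / N%:R).

(* Value at (x_i, t_n); the time index comes first. *)
Definition restrict_grid (R : realType) (a b T : R) (M N : nat)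
    (u : R -> R -> R) (n i : nat) : R :=
  u (xgrid a b M i) (tgrid T N n).

Definition is_truncation_error (R : realType) (alpha lambda K a b T : R)
    (f u : R -> R -> R) (M N n i : nat) (r : R) : Prop :=
  let h := (b - a) / M%:R in
  let tau := T / N%:R in
  let V := restrict_grid a b T M N u in
  let F := restrict_grid a b T M N f in
  Bop lambda h (V n.+1) i - K * tau * Dop alpha lambda h M (V n.+1) i =
  Bop lambda h (V n) i + tau * Bop lambda h (F n.+1) i + tau * r.

Definition truncation_bound (R : realType) (alpha lambda K a b T : R)
    (f u : R -> R -> R) (C : R) : Prop :=
  forall M N n i : nat, (0 < M)%N -> (0 < N)%N ->
    (1 <= i <= M - 1)%N -> (n < N)%N ->
    forall r : R, is_truncation_error alpha lambda K a b T f u M N n i r ->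
      `|r| <= C * (T / N%:R + ((b - a) / M%:R) ^+ 3).

Definition sufficiently_regular (R : realType) (alpha lambda K a b T : R)
    (f : R -> R -> R) (u0 ua : R -> R) (u : R -> R -> R) : Prop :=
  is_unique_solution alpha lambda K a b T f u0 ua u /\
  exists C2 : R, truncation_bound alpha lambda K a b T f u C2.

Definition solves_scheme (R : realType) (alpha lambda K a b T : R)
    (f : R -> R -> R) (u0 ua : R -> R) (M N : nat) (U : nat -> nat -> R)
    : Prop :=
  let h := (b - a) / M%:R in
  let tau := T / N%:R in
  let F := restrict_grid a b T M N f in
  [/\ forall n i : nat, (n < N)%N -> (1 <= i <= M - 1)%N ->
        Bop lambda h (U n.+1) i - K * tau * Dop alpha lambda h M (U n.+1) i =
        Bop lambda h (U n) i + tau * Bop lambda h (F n.+1) i,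
      forall i : nat, (i <= M)%N -> U 0%N i = u0 (xgrid a b M i) &
      forall n : nat, (n <= N)%N -> U n 0%N = ua (tgrid T N n) /\ U n M = 0].

(* The linear system of the scheme can be singular for exceptional values of
   (h, tau), e.g. for M = 2 and large lambda * h; "the" solution of the scheme
   is understood as its only solution. *)
Definition is_scheme_solution (R : realType) (alpha lambda K a b T : R)
    (f : R -> R -> R) (u0 ua : R -> R) (M N : nat) (U : nat -> nat -> R)
    : Prop :=
  solves_scheme alpha lambda K a b T f u0 ua M N U /\
  forall V, solves_scheme alpha lambda K a b T f u0 ua M N V ->
    forall n i : nat, (n <= N)%N -> (i <= M)%N -> V n i = U n i.

Definition grid_norm (R : realType) (h : R) (M : nat) (v : nat -> R) : R :=
  Num.sqrt (h * \sum_(1 <= i < M) v i ^+ 2).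

(* Main.v *)
Require Import Defs.
From HB Require Import structures.
From mathcomp Require Import all_boot all_order all_algebra.
From mathcomp Require Import all_classical all_reals all_analysis.
From mathcomp Require Import measurable_realfun.
From mathcomp Require Import ring lra zify.
Set Implicit Arguments.
Unset Strict Implicit.
Unset Printing Implicit Defensive.
Import Order.TTheory GRing.Theory Num.Theory.
Import numFieldNormedType.Exports.
Local Open Scope classical_set_scope.
Local Open Scope ring_scope.

(* With e = u - U the scheme gives B e' - K tau D e' = B e + tau R, and the proof
   is an energy estimate for this recursion.  The form sum_i V_i (D V)_i is a
   combination of the lag sums S_k = sum_i V_i V_{i+k} with coefficients c_k.
   Those with k >= 3 are nonnegative, c_1 > 0 and c_1 + 4 c_2 > 0, so that
   S_k <= S_0 and 3 S_0 - 4 S_1 + S_2 >= 0 bound the form by the row sum of the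
   weights times S_0; the row sum is controlled through
   sum_{k<=n} g_k x^k <= (1 - x)^alpha.

   Three ranges of (M, N) are treated separately.
   (i) N large: the substitution e_i = exp(lambda i h) W_i makes B symmetric and
   positive, makes the first difference skew and removes lambda from the
   weights, whose form is then <= 0; only the term lambda^alpha (alpha - 1) B
   produces growth, and Gronwall's inequality applies once tau is small.
   (ii) N bounded, M large: for large tau that growth term cannot be absorbed,
   but without the substitution the row sums of D are O(lambda h), so that one
   step amplifies by a constant factor, and there are boundedly many steps.
   (iii) The finitely many remaining pairs (M, N): the solution of the scheme is
   unique, hence its error is one fixed finite number. *)

(** * Lag sums and Toeplitz forms *)

Section LagSums.
Variable R : realFieldType.

Lemma sum_shift (f : nat -> R) M :
  \sum_(0 <= i < M) f i.+1 = \sum_(0 <= i < M) f i + f M - f 0%N.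
Proof.
elim: M => [|M IH]; first by rewrite !big_nil add0r subrr.
rewrite !big_nat_recr //= IH; ring.
Qed.

Lemma sum_skip0 M (U V : nat -> R) k : U 0%N = 0 ->
  \sum_(1 <= i < M) U i * V (i + k)%N = \sum_(0 <= i < M) U i * V (i + k)%N.
Proof.
move=> U0; case: (posnP M) => [->|M0]; first by rewrite !big_geq.
by rewrite [RHS]big_ltn // U0 mul0r add0r.
Qed.

Lemma sum_pred M (U V : nat -> R) : U M = 0 ->
  \sum_(1 <= i < M) U i * V (i - 1)%N = \sum_(0 <= i < M) V i * U (i + 1)%N.
Proof.
move=> UM; case: (posnP M) => [->|M0]; first by rewrite !big_geq.
rewrite -(prednK M0) big_add1 [RHS]big_nat_recr //= addn1 (prednK M0).
rewrite UM mulr0 addr0; apply: eq_bigr => i _.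
by rewrite subn1 addn1 mulrC.
Qed.

(** The autocorrelation of [V] at lag [k]. Indices [i + k] beyond [M] do occur; they contribute
    nothing once [V] is extended by zero. *)
Definition lag_sum (M : nat) (V : nat -> R) (k : nat) : R :=
  \sum_(0 <= i < M) V i * V (i + k)%N.

Variables (M : nat) (V : nat -> R).
Hypotheses (V0 : V 0%N = 0) (Vout : forall j, (M <= j)%N -> V j = 0).

Let S := lag_sum M V.

Lemma lag_sum0_ge0 : 0 <= S 0.
Proof. by apply: sumr_ge0 => i _; rewrite addn0 -expr2 sqr_ge0. Qed.

(** Each further shift loses the square at [k] and gains the one at [M + k], which is zero. *)
Lemma sum_sqr_shift k : \sum_(0 <= i < M) V (i + k)%N ^+ 2 <= S 0.
Proof.
elim: k => [|k IH].
  by apply: ler_sum => i _; rewrite addn0 -expr2.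
apply: le_trans IH.
have := sum_shift (fun i => V (i + k)%N ^+ 2) M.
rewrite (@Vout (M + k)) ?leq_addr // expr0n /= addr0 => E.
rewrite [leLHS](_ : _ = \sum_(0 <= i < M) V (i.+1 + k)%N ^+ 2); last first.
  by apply: eq_bigr => i _; rewrite addSnnS.
by rewrite E lerBlDr lerDl sqr_ge0.
Qed.

(** Termwise 2 |x y| <= x^2 + y^2; both resulting sums of squares are at most [S 0]. *)
Lemma lag_sum_norm k : `|S k| <= S 0.
Proof.
have -> : S 0 = \sum_(0 <= i < M) (V i ^+ 2 / 2) + S 0 / 2.
  have -> : \sum_(0 <= i < M) (V i ^+ 2 / 2) = S 0 / 2.
    by rewrite -mulr_suml; congr (_ / 2); apply: eq_bigr => i _; rewrite addn0.
  by rewrite -splitr.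
apply: le_trans (_ : \sum_(0 <= i < M) (V i ^+ 2 / 2) +
   (\sum_(0 <= i < M) V (i + k)%N ^+ 2) / 2 <= _); last first.
  by rewrite lerD2l ler_pM2r ?invr_gt0 ?ltr0n // sum_sqr_shift.
rewrite mulr_suml -big_split /=.
apply: le_trans (ler_norm_sum _ _ _) _; apply: ler_sum => i _.
have /= := sqr_ge0 (`|V i| - `|V (i + k)%N|).
rewrite normrM -(real_normK (num_real (V i))) -(real_normK (num_real (V (i + k)%N))).
nra.
Qed.

Lemma lag_sum_le k : S k <= S 0.
Proof. exact: le_trans (ler_norm _) (lag_sum_norm k). Qed.

Lemma lag_sum_geN k : - S 0 <= S k.
Proof. by have := lag_sum_norm k; rewrite ler_norml => /andP[]. Qed.

(* Twice the left-hand side is the sum over Z of the squared second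
   differences of V; the one at -1 is V 1. *)
Lemma lag_sum_second_difference : 0 <= 3 * S 0 - 4 * S 1 + S 2.
Proof.
have s1 := sum_shift (fun i => V i ^+ 2) M.
have s2 := sum_shift (fun i => V i.+1 ^+ 2) M.
have s3 := sum_shift (fun i => V i * V i.+1) M.
have : 0 <= V 1%N ^+ 2 + \sum_(0 <= i < M) (V i - 2 * V i.+1 + V i.+2) ^+ 2.
  by rewrite addr_ge0 ?sqr_ge0 //; apply: sumr_ge0 => i _; rewrite sqr_ge0.
have -> : \sum_(0 <= i < M) (V i - 2 * V i.+1 + V i.+2) ^+ 2 =
  \sum_(0 <= i < M) V i ^+ 2 + 4 * (\sum_(0 <= i < M) V i.+1 ^+ 2)
  + \sum_(0 <= i < M) V i.+2 ^+ 2 - 4 * \sum_(0 <= i < M) V i * V i.+1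
  - 4 * \sum_(0 <= i < M) V i.+1 * V i.+2
  + 2 * \sum_(0 <= i < M) V i * V i.+2.
  rewrite !mulr_sumr -!sumrN -!big_split /=; apply: eq_bigr => i _; ring.
rewrite s3 s2 s1 (@Vout M.+1) // (@Vout M) // V0.
have -> : \sum_(0 <= i < M) V i ^+ 2 = S 0.
  by apply: eq_bigr => i _; rewrite addn0 expr2.
have -> : \sum_(0 <= i < M) V i * V i.+1 = S 1.
  by apply: eq_bigr => i _; rewrite addn1.
have -> : \sum_(0 <= i < M) V i * V i.+2 = S 2.
  by apply: eq_bigr => i _; rewrite addn2.
lra.
Qed.

Lemma lag_sum_skip0 k : \sum_(1 <= i < M) V i * V (i + k)%N = S k.
Proof. exact: sum_skip0. Qed.

Lemma lag_sum_pred : \sum_(1 <= i < M) V i * V (i - 1)%N = S 1.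
Proof. by apply: sum_pred; rewrite Vout. Qed.

(** All rows can be extended to a common length [n], since the added terms have index at least [M],
    where [V] vanishes. The weight [w k] then multiplies the lag sum at distance |k - 1|, so [w 0]
    and [w 2] share [S 1]. *)
Lemma toeplitz_formE (w : nat -> R) n : (M < n)%N -> (3 < n)%N ->
  \sum_(1 <= i < M) V i * (\sum_(0 <= k < (M - i + 1).+1) w k * V (i + k - 1)%N)
  = w 1%N * S 0 + (w 0%N + w 2) * S 1 + w 3 * S 2
    + \sum_(4 <= k < n) w k * S k.-1.
Proof.
move=> Mn n3.
have -> : \sum_(1 <= i < M)
     V i * (\sum_(0 <= k < (M - i + 1).+1) w k * V (i + k - 1)%N)
  = \sum_(1 <= i < M) \sum_(0 <= k < n) w k * (V i * V (i + k - 1)%N).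
  apply: eq_big_nat => i /andP[i1 iM]; rewrite mulr_sumr.
  rewrite [RHS](@big_cat_nat _ _ _ (M - i + 1).+1) /=; [|lia|lia].
  rewrite [X in _ = _ + X]big_nat_cond [X in _ = _ + X]big1 ?addr0.
    by apply: eq_bigr => k _; ring.
  by move=> k /andP[/andP[k1 k2] _]; rewrite (Vout (j := i + k - 1)) ?mulr0 //; lia.
rewrite exchange_big /=.
have E k : \sum_(1 <= i < M) w k.+1 * (V i * V (i + k.+1 - 1)%N) = w k.+1 * S k.
  rewrite -lag_sum_skip0 mulr_sumr; apply: eq_bigr => i _.
  by rewrite addnS subn1.
rewrite (@big_ltn _ _ _ 0 n); last lia.
rewrite (@big_ltn _ _ _ 1 n); last lia.
rewrite (@big_ltn _ _ _ 2 n); last lia.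
rewrite (@big_ltn _ _ _ 3 n); last lia.
rewrite !E -mulr_sumr.
have -> : \sum_(1 <= i < M) V i * V (i + 0 - 1)%N = S 1.
  by rewrite -lag_sum_pred; apply: eq_bigr => i _; rewrite addn0.
have -> : \sum_(4 <= i < n) \sum_(1 <= j < M) w i * (V j * V (j + i - 1)%N)
        = \sum_(4 <= k < n) w k * S k.-1.
  apply: eq_big_nat => k /andP[k4 _].
  by rewrite -{1 2}(prednK (ltn_trans (isT : 0 < 3)%N k4)) E prednK //; lia.
ring.
Qed.

(** The parameter [d] is room for the first difference, whose form is a multiple of [S 1]. Replacing
    every lag sum by [S 0] turns the form into the row sum times [S 0]; only the lags 1 and 2 need
    more than the signs of their coefficients. *)
Lemma toeplitz_form_le (w : nat -> R) d n : (M < n)%N -> (3 < n)%N ->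
  (forall k, (3 < k)%N -> 0 <= w k) ->
  0 <= w 0%N + w 2 - d -> 0 <= w 0%N + w 2 - d + 4 * w 3 ->
  \sum_(1 <= i < M) V i * (\sum_(0 <= k < (M - i + 1).+1) w k * V (i + k - 1)%N)
    - d * S 1
  <= (\sum_(0 <= k < n) w k - d) * S 0.
Proof.
move=> Mn n3 w4 d1 d3; rewrite (toeplitz_formE _ Mn n3).
rewrite (@big_ltn _ _ _ 0 n); last lia.
rewrite (@big_ltn _ _ _ 1 n); last lia.
rewrite (@big_ltn _ _ _ 2 n); last lia.
rewrite (@big_ltn _ _ _ 3 n); last lia.
have tl : \sum_(4 <= k < n) w k * S k.-1 <= (\sum_(4 <= k < n) w k) * S 0.
  rewrite mulr_suml; apply: ler_sum_nat => k /andP[k4 _].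
  by apply: ler_wpM2l (lag_sum_le _); apply: w4.
have := lag_sum_second_difference; have := lag_sum_le 1; have := lag_sum_le 2.
move: tl d1 d3.
move: (\sum_(4 <= k < n) w k * S k.-1) (\sum_(4 <= k < n) w k) => A B.
move: (S 0) (S 1) (S 2) (w 0%N) (w 1%N) (w 2) (w 3) => s0 s1 s2 w0 w1 w2 w3.
move=> tl d1 d3 h2 h1 h.
(* If [w3] is negative, [s2] is bounded below by 4 s1 - 3 s0; then [s1] gets the coefficient w0 + w2
   - d + 4 w3, which is nonnegative, and [s1] is at most [s0]. *)
have [w30|w30] := leP 0 w3; nra.
Qed.

End LagSums.

(** * Euler's integral and the recurrence for the weights g *)

Section GammaIntegral.
Variable R : realType.
Implicit Types (x t : R).
Notation mu := (@lebesgue_measure R).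

Definition euler_integrand x t : R := t `^ (x - 1) * expR (- t).

Lemma euler_integrand_ge0 x t : 0 <= euler_integrand x t.
Proof. by rewrite mulr_ge0 ?powR_ge0 ?expR_ge0. Qed.

Lemma measurable_euler_integrand x (D : set R) :
  measurable_fun D (euler_integrand x).
Proof.
apply: measurable_funTS; apply: measurable_funM => //.
apply: continuous_measurable_fun => t.
by apply: continuous_comp; [exact: opp_continuous | exact: continuous_expR].
Qed.

(** Kept in the extended reals, so that monotone convergence applies before finiteness is known;
    [Gamma_integral] is its [fine] part. *)
Definition euler_integral x : \bar R :=
  (\int[mu]_(t in `]0%R, +oo[) (euler_integrand x t)%:E)%E.

(* From u <= e^u at u = t / (2 x). *)
Lemma powR_expR_bound x t : 0 < x -> 0 <= t ->
  t `^ x * expR (- t) <= (2 * x) `^ x * expR (- (t / 2)).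
Proof.
move=> x0 t0.
have -> : expR (- t) = expR (- (t / 2)) * expR (- (t / 2)).
  by rewrite -expRD; congr expR; field.
rewrite mulrA ler_wpM2r ?expR_ge0 // expRN ler_pdivrMr ?expR_gt0 //.
have -> : expR (t / 2) = expR (t / (2 * x)) `^ x.
  by rewrite -expRM; congr expR; field; rewrite gt_eqF.
have x20 : 0 <= 2 * x by rewrite mulr_ge0 // ltW.
rewrite -powRM ?expR_ge0 //.
apply: ge0_ler_powR; rewrite ?nnegrE ?mulr_ge0 ?expR_ge0 ?(ltW x0) //.
have -> : t = 2 * x * (t / (2 * x)) by field; rewrite gt_eqF.
rewrite ler_wpM2l //.
by apply: le_trans (expR_ge1Dx _); rewrite [2 * x * _]mulrC mulfK ?lerDr //;
  rewrite gt_eqF // mulr_gt0.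
Qed.

(** The integrand is dominated by a multiple of the exponential density of rate 1/2. At [x + 1] it
    has no singularity at 0; arguments in ]0, 1] are recovered later from the recurrence. *)
Lemma euler_integral_lty x : 0 < x -> (euler_integral (x + 1) < +oo)%E.
Proof.
move=> x0.
have h0 : 0 < 2^-1 :> R by [].
have := integral_exponential_pdf h0.
set e := exponential_pdf _ => Ie.
have me : measurable_fun setT (EFin \o e).
  by apply/measurable_EFinP; exact: measurable_exponential_pdf.
have e0 t : 0 <= e t by apply: exponential_pdf_ge0.
(* The leading factor 2 cancels the normalization 1/2 of the density. *)
apply: (@le_lt_trans _ _ (\int[mu]_t ((2 * (2 * x) `^ x)%:E * (e t)%:E))%E); last first.
  rewrite ge0_integralZl_EFin //.
  - by rewrite Ie mule1 ltry.
  - by move=> t _; rewrite lee_fin.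
  - by rewrite mulr_ge0 // powR_ge0.
apply: (@le_trans _ _ (\int[mu]_(t in `]0%R, +oo[) ((2 * (2 * x) `^ x)%:E * (e t)%:E))%E).
  apply: ge0_le_integral => //.
  - by move=> t _; rewrite lee_fin euler_integrand_ge0.
  - by apply/measurable_EFinP; exact: measurable_euler_integrand.
  - apply: measurable_funTS; apply: measurable_funeM => //.
  move=> t /=; rewrite in_itv /= andbT => t0.
  rewrite -EFinM lee_fin /e exponential_pdfE ?(ltW t0) // /euler_integrand addrK.
  apply: le_trans (powR_expR_bound x0 (ltW t0)) _.
  rewrite le_eqVlt; apply/orP; left; apply/eqP.
  have -> : - 2^-1 * t = - (t / 2) by ring.
  by field.
apply: ge0_subset_integral => //.
- by apply: measurable_funeM.
- by move=> t _; rewrite -EFinM lee_fin mulr_ge0 // mulr_ge0 // powR_ge0.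
Qed.

Lemma euler_integral_ge0 x : (0 <= euler_integral x)%E.
Proof. by apply: integral_ge0 => t _; rewrite lee_fin euler_integrand_ge0. Qed.

Lemma euler_integrand_by_parts x (a b : R) : 0 <= x -> 0 < a -> a < b ->
  (\int[mu]_(t in `[a, b]) (euler_integrand (x + 1) t)%:E =
  (a `^ x * expR (- a) - b `^ x * expR (- b))%:E
  + x%:E * \int[mu]_(t in `[a, b]) (euler_integrand x t)%:E)%E.
Proof.
move=> x0 a0 ab.
have dpow p t : t \in `[a, b] -> is_derive t 1 (@powR R ^~ p) (p * t `^ (p - 1)).
  by rewrite in_itv /= => /andP[at_ _]; apply: is_derive1_powR; exact: lt_le_trans at_.
have dexp t : is_derive t 1 (fun t => - expR (- t)) (expR (- t)).
  have d1 := is_deriveNid t (1 : R).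
  have d2 := @is_derive1_comp _ expR (fun t => - t) t _ _ (is_derive_expR _) d1.
  by apply: (is_derive_eq (is_deriveN d2)); rewrite mulrN1 opprK.
have itvW t : t \in `]a, b[ -> t \in `[a, b].
  by rewrite !in_itv /= => /andP[/ltW -> /ltW ->].
have ina : a \in `[a, b] by rewrite in_itv /= lexx ltW.
have inb : b \in `[a, b] by rewrite in_itv /= lexx ltW.
have cont (f : R -> R) t df : is_derive t 1 f df -> {for t, continuous f}.
  by move=> [d _]; apply: differentiable_continuous; exact/derivable1_diffP.
transitivity (\int[mu]_(t in `[a, b]) (t `^ x * expR (- t))%:E)%E.
  by apply: eq_integral => t _; rewrite /euler_integrand addrK.
rewrite (@integration_by_parts R (@powR R ^~ x) (fun t => - expR (- t))
  (fun t => x * t `^ (x - 1)) (fun t => expR (- t)) a b ab).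
- congr (_ + _)%E; first by congr EFin; ring.
  under eq_integral => t _.
    rewrite (_ : (_ * _)%:E = (- (x%:E * (euler_integrand x t)%:E))%E); first over.
    by rewrite -EFinM -EFinN; congr EFin; rewrite /euler_integrand; ring.
  rewrite integral_ge0N ?oppeK ?ge0_integralZl_EFin //.
  - by move=> t _; rewrite lee_fin euler_integrand_ge0.
  - by apply/measurable_EFinP; exact: measurable_euler_integrand.
  - by move=> t _; rewrite -EFinM lee_fin mulr_ge0 ?euler_integrand_ge0.
- apply: derivable_within_continuous => t tab.
  by have [] := is_deriveZ x (dpow (x - 1) t tab).
- split.
  + by move=> t /itvW tab; have [] := dpow x t tab.
  + by apply/cvg_at_right_filter; exact: cont (dpow x a ina).
  + by apply/cvg_at_left_filter; exact: cont (dpow x b inb).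
- by move=> t /itvW tab; rewrite derive1E; have [_ ->] := dpow x t tab.
- apply: derivable_within_continuous => t _.
  by have [] := is_deriveN (dexp t); rewrite opprK.
- split.
  + by move=> t _; have [] := dexp t.
  + by apply/cvg_at_right_filter; exact: cont (dexp a).
  + by apply/cvg_at_left_filter; exact: cont (dexp b).
- by move=> t _; rewrite derive1E; have [_ ->] := dexp t.
Qed.

(** Integration by parts on compact intervals exhausting ]0, +oo[, with monotone convergence of both
    integrals and vanishing boundary terms. *)
Lemma euler_integralS x : 0 < x ->
  (euler_integral (x + 1) = x%:E * euler_integral x)%E.
Proof.
move=> x0.
(* The factor 2 in [b] makes exp(- b n / 2), as it occurs in [powR_expR_bound], equal to exp(- (n +
   1)), a known null sequence. *)
pose a n : R := n.+1%:R^-1; pose b n : R := 2 * n.+1%:R.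
have a0 n : 0 < a n by rewrite invr_gt0 ltr0n.
have a1 n : a n <= 1 by rewrite invf_le1 ?ltr0n // ler1n.
have b1 n : 1 < b n.
  by apply: (@lt_le_trans _ _ 2); rewrite ?ltr1n // ler_peMr // ler1n.
have ab n : a n < b n := le_lt_trans (a1 n) (b1 n).
pose D n := `[a n, b n]%classic.
have DE : `]0, +oo[%classic = \bigcup_n D n.
  apply/seteqP; split=> [t|t [n _]] /=; rewrite !in_itv /=; last first.
    by move=> /andP[t1 _]; rewrite andbT (lt_le_trans (a0 n) t1).
  rewrite andbT => t0; pose n := (Num.bound t + Num.bound t^-1)%N.
  have t'0 : 0 <= t^-1 by rewrite invr_ge0 ltW.
  have n1 : t <= n.+1%:R.
    apply: le_trans (ltW (archi_boundP (ltW t0))) _; rewrite ler_nat.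
    by rewrite leqW // leq_addr.
  have n2 : t^-1 <= n.+1%:R.
    apply: le_trans (ltW (archi_boundP t'0)) _; rewrite ler_nat.
    by rewrite leqW // leq_addl.
  exists n => //; rewrite /D /= in_itv /= /a /b; apply/andP; split.
    by rewrite -(invrK t) lef_pV2 // posrE ?invr_gt0 // ltr0n.
  by apply: le_trans n1 _; rewrite ler_peMl // ler1n.
have cvgI y : (\int[mu]_(t in D n) (euler_integrand y t)%:E @[n --> \oo]
    --> euler_integral y)%E.
  rewrite /euler_integral DE; apply: ge0_nondecreasing_set_cvg_integral => //.
  - apply/nondecreasing_seqP => n; rewrite subsetEset /D => t /=.
    rewrite !in_itv /= => /andP[ta tb]; apply/andP; split.
      by apply: le_trans ta; rewrite lef_pV2 ?posrE ?ltr0n // ler_nat.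
    by apply: le_trans tb _; rewrite ler_pM2l // ler_nat.
  - by move=> n; exact: measurable_itv.
  - by move=> n; apply/measurable_EFinP; exact: measurable_euler_integrand.
  - by move=> n t _; rewrite lee_fin euler_integrand_ge0.
pose c n := a n `^ x * expR (- a n) - b n `^ x * expR (- b n).
have cvgc : (c n)%:E @[n --> \oo] --> 0%E.
  apply: cvg_EFin; first exact: nearW.
  rewrite -(subr0 0); apply: cvgB.
    have aint : a n `^ x @[n --> \oo] --> 0.
      have /cvg_at_rightP := powR_cvg0 x0; apply; split=> //.
      exact: cvg_harmonic.
    apply: (squeeze_cvgr _ (cvg_cst 0) aint); apply: nearW => n.
    rewrite mulr_ge0 ?powR_ge0 ?expR_ge0 //=.
    by rewrite ler_piMr ?powR_ge0 // expR_le1 oppr_le0 ltW.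
  have bint : (2 * x) `^ x * expR (- n.+1%:R) @[n --> \oo] --> 0.
    rewrite -(mulr0 ((2 * x) `^ x)); apply: cvgMr.
    by have := @cvgn_expR R; rewrite -cvg_shiftS.
  apply: (squeeze_cvgr _ (cvg_cst 0) bint); apply: nearW => n.
  rewrite mulr_ge0 ?powR_ge0 ?expR_ge0 //=.
  have := powR_expR_bound x0 (ltW (lt_trans ltr01 (b1 n))).
  by rewrite {3}/b [2 * _ / 2]mulrC mulKf.
have : (\int[mu]_(t in D n) (euler_integrand (x + 1) t)%:E @[n --> \oo]
    --> 0 + x%:E * euler_integral x)%E.
  under eq_fun do rewrite (euler_integrand_by_parts (ltW x0) (a0 _) (ab _)).
  apply: cvgeD => //; exact: cvgeZl (cvgI x).
rewrite add0e => /(cvg_unique _ (cvgI (x + 1))); exact.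
Qed.

(** On [1, 2] one has t^(x - 1) = t^x / t >= 1/2 and exp(- t) >= exp(- 2). *)
Lemma euler_integral_gt0 x : 0 < x -> (0 < euler_integral x)%E.
Proof.
move=> x0.
apply: (@lt_le_trans _ _ (\int[mu]_(t in `[1%R, 2%R]) (cst (expR (- 2) / 2)%:E t))%E).
  rewrite integral_cst; last exact: measurable_itv.
  have m12 : mu `[1%R, 2%R]%classic = 1%:E.
    rewrite lebesgue_measure_itv /= lte_fin ltr1n -EFinD; congr EFin; lra.
  rewrite [X in (_ * X)%E](_ : _ = 1%:E); last exact: m12.
  by rewrite mule1 lte_fin divr_gt0 ?expR_gt0.
apply: (@le_trans _ _ (\int[mu]_(t in `[1%R, 2%R]) (euler_integrand x t)%:E)%E).
  apply: ge0_le_integral => //.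
  - by move=> t _; rewrite lee_fin divr_ge0 ?expR_ge0.
  - by apply/measurable_EFinP; exact: measurable_euler_integrand.
  move=> t /=; rewrite in_itv /= => /andP[t1 t2]; rewrite lee_fin mulrC.
  apply: ler_pM; rewrite ?invr_ge0 ?expR_ge0 //; last by rewrite ler_expR lerN2.
  have t0 : 0 < t := lt_le_trans ltr01 t1.
  rewrite powRB; last by rewrite (gt_eqF t0) implybT.
  rewrite powRr1 ?(ltW t0) // -[leLHS]mul1r; apply: ler_pM => //.
    by rewrite -(powRr0 t) ler_powR // ltW.
  by rewrite lef_pV2 ?posrE.
apply: ge0_subset_integral => //.
- by apply/measurable_EFinP; exact: measurable_euler_integrand.
- by move=> t _; rewrite lee_fin euler_integrand_ge0.
- by move=> t /=; rewrite !in_itv /= andbT => /andP[t1 _]; exact: lt_le_trans t1.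
Qed.

Lemma euler_integral1 : euler_integral 1 = 1%E.
Proof.
have h0 : 0 < 1 :> R by [].
rewrite -(integral_exponential_pdf h0) /euler_integral.
rewrite [RHS](_ : _ = \int[mu]_(t in `[0%R, +oo[) (exponential_pdf 1 t)%:E)%E; last first.
  rewrite [RHS]integral_mkcond; apply: eq_integral => t _.
  rewrite /patch; case: ifPn => // /negP; rewrite inE /= in_itv /= andbT => /negP.
  by rewrite -ltNge => t0; rewrite lt0_exponential_pdf.
rewrite -integral_itv_obnd_cbnd; last first.
  by apply/measurable_EFinP/measurable_funTS; exact: measurable_exponential_pdf.
apply: eq_integral => t; rewrite inE /= in_itv /= andbT => t0.
rewrite exponential_pdfE ?ltW //; congr EFin.
by rewrite /euler_integrand subrr powRr0 mul1r mul1r mulN1r.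
Qed.

Lemma Gamma_integralE x : Gamma_integral x = fine (euler_integral x).
Proof. by []. Qed.

Lemma Gamma_integral1 : Gamma_integral 1 = 1 :> R.
Proof. by rewrite Gamma_integralE euler_integral1. Qed.

(** Were the value at [x] infinite, the recurrence would make the value at [x + 1] infinite as
    well. *)
Lemma euler_integral_fin_num x : 0 < x -> euler_integral x \is a fin_num.
Proof.
move=> x0; rewrite ge0_fin_numE ?euler_integral_ge0 //.
have := euler_integral_lty x0; rewrite euler_integralS //.
case: (euler_integral x) => [r|//|//]; first by rewrite !ltry.
by rewrite gt0_muley ?lte_fin.
Qed.

Lemma Gamma_integralS x : 0 < x -> Gamma_integral (x + 1) = x * Gamma_integral x.
Proof.
move=> x0; rewrite !Gamma_integralE euler_integralS // fineM //.
exact: euler_integral_fin_num.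
Qed.

Lemma Gamma_integral_gt0 x : 0 < x -> 0 < Gamma_integral x.
Proof.
move=> x0; rewrite Gamma_integralE; apply: fine_gt0.
by rewrite euler_integral_gt0 // -ge0_fin_numE ?euler_integral_fin_num // euler_integral_ge0.
Qed.

End GammaIntegral.

(** * The continued Gamma function and the recurrence for g *)

Section Gweight.
Variable R : realType.
Implicit Types alpha x : R.

Lemma Gamma_pos x : 0 < x -> Gamma x = Gamma_integral x.
Proof. by move=> x0; rewrite /Gamma x0 big_ord0 divr1 addr0. Qed.

(** Only k = 0 and k = 1 involve the continuation: - alpha and 1 - alpha have floors -2 and -1. For
    k >= 2 both arguments are positive and the recurrence of Euler's integral applies. *)
Lemma GammaS alpha (k : nat) : 1 < alpha < 2 ->
  Gamma (k.+1%:R - alpha) = (k%:R - alpha) * Gamma (k%:R - alpha).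
Proof.
move=> /andP[a1 a2].
have fl (m : int) x : m%:~R <= x < (m + 1)%:~R -> Num.floor x = m by exact: floor_def.
have E1 : Gamma (1 - alpha) = Gamma_integral (2 - alpha) / (1 - alpha).
  rewrite /Gamma ifF; last by apply/negbTE; rewrite -leNgt; lra.
  rewrite (fl (-1)) /=; last by apply/andP; split; lra.
  by rewrite big_ord1 addr0; congr (Gamma_integral _ / _); ring.
case: k => [|[|k]].
- rewrite sub0r E1 /Gamma ifF; last by apply/negbTE; rewrite -leNgt; lra.
  rewrite (fl (-2)) /=; last by apply/andP; split; lra.
  rewrite !big_ord_recl big_ord0 /= /bump /= addr0 addrC mulr1.
  rewrite [1%:R + _]addrC; field; apply/andP; split; lra.
- rewrite E1 Gamma_pos; last by lra.
  by rewrite mulrCA mulfV ?mulr1 //; lra.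
have k0 : 0 < k.+2%:R - alpha.
  by apply: lt_le_trans (_ : 2 - alpha <= _); [lra | rewrite lerB // ler_nat].
rewrite !Gamma_pos //; last by apply: lt_le_trans k0 _; rewrite lerB // ler_nat.
by rewrite -Gamma_integralS //; congr Gamma_integral; rewrite -(natr1 k.+2); ring.
Qed.

(** Two steps of the recurrence would propagate a zero to Gamma(2 - alpha), a positive integral. *)
Lemma Gamma_opp_neq0 alpha : 1 < alpha < 2 -> Gamma (- alpha) != 0.
Proof.
move=> ha; have /andP[a1 a2] := ha; apply/eqP => G0.
have := GammaS 1 ha; rewrite (GammaS 0 ha) sub0r G0 !mulr0 Gamma_pos; last by lra.
by apply/eqP; rewrite gt_eqF // Gamma_integral_gt0 //; lra.
Qed.

Lemma Gamma_nat_neq0 (k : nat) : Gamma (k%:R + 1) != 0 :> R.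
Proof. by rewrite Gamma_pos ?gt_eqF ?Gamma_integral_gt0 // ltr_wpDl. Qed.

Lemma gweight0 alpha : 1 < alpha < 2 -> gweight alpha 0 = 1.
Proof.
move=> ha; have G1 : Gamma (0%:R + 1) = 1 :> R.
  by rewrite add0r Gamma_pos // Gamma_integral1.
by rewrite /gweight sub0r G1 mulr1 mulfV // Gamma_opp_neq0.
Qed.

(** Together with g_0 = 1 this identifies g_k with (-1)^k binom(alpha, k), the Taylor coefficients
    of (1 - x)^alpha. From here on g is handled only through these two facts. *)
Lemma gweightS alpha k : 1 < alpha < 2 ->
  gweight alpha k.+1 = gweight alpha k * ((k%:R - alpha) / k.+1%:R).
Proof.
move=> ha; rewrite /gweight (GammaS k ha).
have k1 : 0 < k%:R + 1 :> R by rewrite ltr_wpDl.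
have -> : Gamma (k.+1%:R + 1) = k.+1%:R * Gamma (k%:R + 1) :> R.
  rewrite -natr1 Gamma_pos; last by rewrite ltr_wpDl ?ltW.
  by rewrite Gamma_integralS // Gamma_pos.
have := Gamma_opp_neq0 ha; have := Gamma_nat_neq0 k.
move: (Gamma (- alpha)) (Gamma (k%:R + 1)) (Gamma (k%:R - alpha)) => A B G A0 B0.
have : k.+1%:R != 0 :> R by rewrite pnatr_eq0.
by move: (k.+1%:R : R) => m m0; field; rewrite A0 B0 m0.
Qed.

End Gweight.

(** * The weights w *)

Section Weights.
Variables (R : realType) (alpha : R).
Hypothesis (halpha : 1 < alpha < 2).

Let gw0 := gweight0 halpha.
Let gwS k := gweightS k halpha.

(* Otherwise unification unfolds the weights down to Lebesgue integrals. *)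
Opaque gweight.

Lemma gweight1 : gweight alpha 1 = - alpha.
Proof. by rewrite gwS gw0 sub0r mul1r divr1. Qed.

Lemma gweight2 : gweight alpha 2 = alpha * (alpha - 1) / 2.
Proof. by rewrite gwS gweight1; field. Qed.

Lemma gweight_ge0 k : 0 <= gweight alpha k.+2.
Proof.
case/andP: halpha => a1 a2.
elim: k => [|k IH]; first by rewrite gweight2; nra.
rewrite gwS mulr_ge0 // divr_ge0 ?ler0n // subr_ge0.
by apply: le_trans (_ : 2%:R <= _); [lra | rewrite ler_nat].
Qed.

(** By the recurrence (k + 1) g_{k+1} = (k - alpha) g_k, so k g_k decreases from k = 2 on. The decay
    1/k controls the truncation of the row sums. *)
Lemma gweight_le k : k.+2%:R * gweight alpha k.+2 <= 2.
Proof.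
case/andP: halpha => a1 a2.
elim: k => [|k IH]; first by rewrite gweight2; nra.
apply: le_trans IH.
rewrite gwS mulrCA [_ / _]mulrC mulVKf ?pnatr_eq0 // mulrC.
by rewrite ler_wpM2r ?gweight_ge0 //; lra.
Qed.

(** Partial sums of the binomial series of (1 - x)^alpha; [gweight_dpsum] below is their
    derivative. *)
Definition gweight_psum (n : nat) (x : R) : R :=
  \sum_(0 <= k < n.+1) gweight alpha k * x ^+ k.

Lemma gweight_psumS n x :
  gweight_psum n.+1 x = gweight_psum n x + gweight alpha n.+1 * x ^+ n.+1.
Proof. by rewrite /gweight_psum big_nat_recr. Qed.

Lemma gweight_psum0 x : gweight_psum 0 x = 1.
Proof. by rewrite /gweight_psum big_nat1 gw0 expr0 mulr1. Qed.

Definition gweight_dpsum (n : nat) (x : R) : R :=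
  \sum_(0 <= k < n) gweight alpha k.+1 * (k.+1%:R * x ^+ k).

Lemma gweight_dpsumS n x : gweight_dpsum n.+1 x =
  gweight_dpsum n x + gweight alpha n.+1 * (n.+1%:R * x ^+ n).
Proof. by rewrite /gweight_dpsum big_nat_recr. Qed.

Lemma is_derive_gweight_psum n (x : R) :
  is_derive x 1 (gweight_psum n) (gweight_dpsum n x).
Proof.
elim: n => [|n IH].
  rewrite (_ : gweight_psum 0 = cst 1); last first.
    by apply/funext => y; rewrite gweight_psum0.
  by rewrite /gweight_dpsum big_nil; exact: is_derive_cst.
rewrite (_ : gweight_psum n.+1 = gweight_psum n + gweight alpha n.+1 *: (id ^+ n.+1)); last first.
  by apply/funext => y; rewrite gweight_psumS !fctE.
rewrite gweight_dpsumS.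
have := is_deriveX n.+1 (is_derive_id x (1 : R)) => /(is_deriveZ (gweight alpha n.+1)).
move=> /(is_deriveD IH) d; apply: (is_derive_eq d).
by rewrite /GRing.scale /= mulr1 mulr_natl.
Qed.

(* The truncation at order n of the equation (1 - x) G' + alpha G = 0
   satisfied by G = (1 - x)^alpha. *)
Lemma gweight_psum_ode n x :
  (1 - x) * gweight_dpsum n x + alpha * gweight_psum n x
  = - (n.+1%:R * gweight alpha n.+1 * x ^+ n).
Proof.
elim: n => [|n IH].
  by rewrite gweight_psum0 /gweight_dpsum big_nil gweight1 expr0; ring.
rewrite gweight_psumS gweight_dpsumS.
rewrite [gweight alpha n.+2]gwS.
have -> : n.+2%:R * (gweight alpha n.+1 * ((n.+1%:R - alpha) / n.+2%:R)) =
  gweight alpha n.+1 * (n.+1%:R - alpha).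
  by rewrite mulrCA [_ / _]mulrC mulVKf ?pnatr_eq0.
move: IH; rewrite exprS; move: (gweight_dpsum n x) (gweight_psum n x) => D P IH.
transitivity ((1 - x) * D + alpha * P + gweight alpha n.+1 * x ^+ n *
   ((1 - x) * n.+1%:R + alpha * x)); first by ring.
rewrite IH; ring.
Qed.

(** The quotient [H] of the two sides equals 1 at 0, and by the truncated differential equation its
    derivative has the sign of - g_{n+2}, hence is nonpositive. At x = 1, where the quotient is
    singular, the equation itself gives the sign of the partial sum. *)
Lemma gweight_psum_le n (x : R) : 0 < x <= 1 -> gweight_psum n.+1 x <= (1 - x) `^ alpha.
Proof.
case/andP: halpha => a1 a2 /andP[x0]; rewrite le_eqVlt => /predU1P[->|x1].
  rewrite subrr powR0; last lra.
  have := gweight_psum_ode n.+1 1; rewrite subrr mul0r add0r expr1n mulr1 => E.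
  have : alpha * gweight_psum n.+1 1 <= 0.
    by rewrite E oppr_le0 mulr_ge0 ?ler0n // gweight_ge0.
  by nra.
pose H y := gweight_psum n.+1 y * (1 - y) `^ (- alpha).
pose H' y := (gweight_dpsum n.+1 y) * (1 - y) `^ (- alpha)
   + gweight_psum n.+1 y * (alpha * (1 - y) `^ (- alpha - 1)).
have dH (y : R) : y < 1 -> is_derive y 1 H (H' y).
  move=> y1.
  have d1 := is_derive_gweight_psum n.+1 y.
  have d2 : is_derive y 1 (fun y => 1 - y) (-1 : R).
    by apply: (is_derive_eq (is_deriveB (is_derive_cst (1 : R) y 1) (is_derive_id y 1)));
      rewrite sub0r.
  have d3 : is_derive (1 - y) 1 (@powR R ^~ (- alpha)) (- alpha * (1 - y) `^ (- alpha - 1)).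
    by apply: is_derive1_powR; rewrite subr_gt0.
  have d4 : is_derive y 1 (fun y => (1 - y) `^ (- alpha)) (alpha * (1 - y) `^ (- alpha - 1)).
    have := @is_derive1_comp _ (@powR R ^~ (- alpha)) (fun y => 1 - y) y _ _ d3 d2.
    by rewrite /comp; move=> d; apply: is_derive_eq; ring.
  have d5 := is_deriveM d1 d4.
  apply: (is_derive_eq d5); rewrite /H' /GRing.scale /=; ring.
have H0 : H 0 = 1.
  rewrite /H subr0 powR1 mulr1 /gweight_psum big_ltn // gw0 expr0 mulr1.
  rewrite big_add1 big1 ?addr0 // => k _; by rewrite exprS mul0r mulr0.
have H'le (y : R) : 0 <= y < 1 -> H' y <= 0.
  move=> /andP[y0 y1].
  have y10 : 0 < 1 - y by rewrite subr_gt0.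
  have -> : H' y = (1 - y) `^ (- alpha - 1) *
      ((1 - y) * gweight_dpsum n.+1 y + alpha * gweight_psum n.+1 y).
    rewrite /H'; have -> : (1 - y) `^ (- alpha) = (1 - y) `^ (- alpha - 1) * (1 - y).
      rewrite -[X in _ * X](powRr1 (ltW y10)) -powRD ?subrK //.
      by apply/implyP => _; rewrite gt_eqF.
    ring.
  rewrite gweight_psum_ode mulrN oppr_le0 mulr_ge0 ?powR_ge0 //.
  apply: mulr_ge0; last exact: exprn_ge0.
  by apply: mulr_ge0; rewrite ?ler0n ?gweight_ge0.
have Hx : H x <= H 0.
  apply: (@ler0_derive1_le_cc _ H 0 x); rewrite ?in_itv /= ?lexx ?(ltW x0) //.
  - move=> y; rewrite in_itv /= => /andP[y0 yx].
    by have [] := dH y (lt_trans yx x1).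
  - move=> y; rewrite in_itv /= => /andP[y0 yx].
    rewrite derive1E; have [_ ->] := dH y (lt_trans yx x1).
    by apply: H'le; rewrite (ltW y0) (lt_trans yx x1).
  - apply: derivable_within_continuous => y; rewrite in_itv /= => /andP[y0 yx].
    by have [] := dH y (le_lt_trans yx x1).
have x10 : 0 < 1 - x by rewrite subr_gt0.
by move: Hx; rewrite H0 /H powRN ler_pdivrMr ?powR_gt0 // mul1r.
Qed.

Lemma wweightE2 lambda h k : wweight alpha lambda h k.+2 =
  (mu_1 alpha * gweight alpha k.+2 + mu_0 alpha * gweight alpha k.+1
   + mu_m1 alpha * gweight alpha k) * expR (- (lambda * h)) ^+ k.+1.
Proof.
rewrite /wweight -expRM_natl; congr (_ * expR _).
by have -> : k.+2%:R = k.+1%:R + 1 :> R; [rewrite natr1 | ring].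
Qed.

(** By the recurrence the three g's are multiples of g_{k+2} >= 0, so that the sign is that of a
    polynomial in m = k and t = alpha - 1. *)
Lemma wweight_ge0 lambda h k : 0 <= wweight alpha lambda h k.+4.
Proof.
case/andP: halpha => a1 a2.
rewrite wweightE2 mulr_ge0 ?exprn_ge0 ?expR_ge0 //.
set g := gweight alpha k.+2; have g0 : 0 <= g := gweight_ge0 k.
rewrite 2!gwS -/g.
have -> : mu_1 alpha * (g * ((k.+2%:R - alpha) / k.+3%:R) *
    ((k.+3%:R - alpha) / k.+4%:R)) +
  mu_0 alpha * (g * ((k.+2%:R - alpha) / k.+3%:R)) + mu_m1 alpha * g =
  g / (k.+3%:R * k.+4%:R) * (mu_1 alpha * ((k.+2%:R - alpha) * (k.+3%:R - alpha))
   + mu_0 alpha * (k.+4%:R * (k.+2%:R - alpha)) + mu_m1 alpha * (k.+3%:R * k.+4%:R)).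
  have n3 : k.+3%:R != 0 :> R by rewrite pnatr_eq0.
  have n4 : k.+4%:R != 0 :> R by rewrite pnatr_eq0.
  move: n3 n4; move: (k.+3%:R : R) (k.+4%:R : R) (k.+2%:R : R) => x y z x0 y0.
  by field; rewrite x0 y0.
apply: mulr_ge0; first by rewrite divr_ge0 // mulr_ge0 ?ler0n.
have -> : k.+4%:R = k%:R + 4 :> R by rewrite -natrD addn4.
have -> : k.+3%:R = k%:R + 3 :> R by rewrite -natrD addn3.
have -> : k.+2%:R = k%:R + 2 :> R by rewrite -natrD addn2.
have : 0 <= k%:R :> R by [].
move: (k%:R : R) => m m0; rewrite /mu_1 /mu_0 /mu_m1.
have [t [t0 t1 ->]] : exists t, [/\ 0 < t, t < 1 & alpha = 1 + t].
  by exists (alpha - 1); split; lra.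
rewrite [leRHS](_ : _ = (24 * m ^+ 2 + 12 * m * (8 - 5 * t - t ^+ 2)
    + (72 - 114 * t + 37 * t ^+ 2 + 26 * t ^+ 3 + 3 * t ^+ 4)) / 24); last by field.
apply: divr_ge0 => //; apply: addr_ge0.
  apply: addr_ge0; first by nra.
  by apply: mulr_ge0; nra.
(* The part free of m is smallest near t = 4/5, which suggests these squares as certificates. *)
have t2 : 0 <= t * (5 * t - 4) ^+ 2 by rewrite mulr_ge0 ?sqr_ge0 // ltW.
have t4 : 0 <= t ^+ 4 by rewrite exprn_ge0 // ltW.
by have := sqr_ge0 (5 * t - 4); nra.
Qed.

(* The coefficients w 2 and w 3 of the weights at lambda h = 0. *)
Definition lag1 : R :=
  mu_1 alpha * gweight alpha 2 + mu_0 alpha * gweight alpha 1 + mu_m1 alpha.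

Definition lag2 : R :=
  mu_1 alpha * gweight alpha 3 + mu_0 alpha * gweight alpha 2
  + mu_m1 alpha * gweight alpha 1.

(** The first two are the sign conditions of [toeplitz_form_le] at lambda h = 0, d = 0. Strictness
    leaves room for small lambda h; the second margin is of order alpha - 1, hence the factor t
    extracted in the proof. *)
Lemma lag_bounds : [/\ 0 < mu_1 alpha + lag1, 0 < mu_1 alpha + lag1 + 4 * lag2,
  `|lag1| <= 2 & `|lag2| <= 1].
Proof.
case/andP: halpha => a1 a2.
rewrite /lag1 /lag2 (gwS 2) gweight2 gweight1 /mu_1 /mu_0 /mu_m1.
have [t [t0 t1 ->]] : exists t, [/\ 0 < t, t < 1 & alpha = 1 + t].
  by exists (alpha - 1); split; lra.
have t2 : 0 <= t ^+ 2 <= 1 by rewrite exprn_ge0 ?exprn_ile1 // ltW.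
have t3 : 0 <= t ^+ 3 <= 1 by rewrite exprn_ge0 ?exprn_ile1 // ltW.
have t4 : 0 <= t ^+ 4 <= 1 by rewrite exprn_ge0 ?exprn_ile1 // ltW.
have t5 : 0 <= t ^+ 5 <= 1 by rewrite exprn_ge0 ?exprn_ile1 // ltW.
rewrite !ler_norml; split; last 2 first.
- by apply/andP; split; lra.
- by apply/andP; split; lra.
- by lra.
rewrite [ltRHS](_ : _ =
  t * (300 + 221 * t - 222 * t ^+ 2 - 107 * t ^+ 3 - 12 * t ^+ 4) / 144);
  last by field.
have tn k : t ^+ k.+1 <= t by rewrite exprS ler_piMr ?exprn_ile1 // ltW.
apply: divr_gt0; last by rewrite ltr0n.
apply: mulr_gt0; first exact: t0.
by have := tn 1%N; have := tn 2%N; have := tn 3%N; lra.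
Qed.

Lemma mu_bounds : [/\ 0 <= mu_1 alpha <= 2, `|mu_0 alpha| <= 1, `|mu_m1 alpha| <= 1
  & mu_1 alpha + mu_0 alpha + mu_m1 alpha = 1].
Proof.
case/andP: halpha => a1 a2; rewrite /mu_1 /mu_0 /mu_m1 !ler_norml.
split; first [by apply/andP; split; nra | by field].
Qed.

(** With z = 1 / x, w_k is z x^k times a combination of g_k, g_{k-1} and g_{k-2}, the g's of
    negative index being 0. Each index shift costs one factor x and one order of the partial sum. *)
Lemma sum_wweightE lambda h n : let x := expR (- (lambda * h)) in
  \sum_(0 <= k < n.+3) wweight alpha lambda h k =
  mu_1 alpha * expR (lambda * h) * gweight_psum n.+2 x
  + mu_0 alpha * gweight_psum n.+1 x + mu_m1 alpha * x * gweight_psum n x.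
Proof.
move=> x.
have zx : expR (lambda * h) * x = 1 by rewrite /x expRxMexpNx_1.
have wE := wweightE2 lambda h; rewrite -/x in wE.
have w0 : wweight alpha lambda h 0 = mu_1 alpha * expR (lambda * h).
  by rewrite /wweight gw0 mulr1.
have w1 : wweight alpha lambda h 1 = mu_1 alpha * gweight alpha 1 + mu_0 alpha.
  by rewrite /wweight gw0 mulr1.
move: (wweight alpha lambda h) w0 w1 wE => w w0 w1 wE.
elim: n => [|n IH].
  rewrite big_nat_recr //= big_nat_recr //= big_nat1 !gweight_psumS gweight_psum0.
  rewrite wE w0 w1 gw0 !expr1.
  transitivity (mu_1 alpha * expR (lambda * h)
     + mu_1 alpha * gweight alpha 1 * (expR (lambda * h) * x)
     + mu_1 alpha * gweight alpha 2 * (expR (lambda * h) * x) * x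
     + mu_0 alpha + mu_0 alpha * gweight alpha 1 * x + mu_m1 alpha * x).
    rewrite zx; ring.
  ring.
rewrite big_nat_recr //= IH wE.
rewrite !gweight_psumS.
have E : expR (lambda * h) * x ^+ n.+3 = x ^+ n.+2 by rewrite exprS mulrA zx mul1r.
move: E; move: (x ^+ n.+3) (gweight_psum n x) => x3 P E.
apply/eqP; rewrite -subr_eq0; apply/eqP.
transitivity (mu_1 alpha * gweight alpha n.+3 * (x ^+ n.+2 - expR (lambda * h) * x3)).
  by rewrite !exprS; ring.
by rewrite E subrr mulr0.
Qed.

Lemma sum_wweight_le lambda h n : 0 <= lambda * h ->
  \sum_(0 <= k < n.+4) wweight alpha lambda h k <=
  (mu_1 alpha * expR (lambda * h) + mu_0 alpha + mu_m1 alpha * expR (- (lambda * h)))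
  * (1 - expR (- (lambda * h))) `^ alpha + 6 / n.+1%:R.
Proof.
move=> s0; rewrite sum_wweightE.
set z := expR (lambda * h); set x := expR (- (lambda * h)).
have x0 : 0 < x := expR_gt0 _.
have x1 : x <= 1 by rewrite /x expR_le1 oppr_le0.
have z1 : 1 <= z by rewrite /z -expR0 ler_expR.
have := @gweight_psum_le n.+2 x; rewrite x0 x1 => /(_ isT).
have g1 := gweight_ge0 n; have g2 := gweight_ge0 n.+1.
have xn k : 0 <= x ^+ k <= 1 by rewrite exprn_ge0 ?exprn_ile1 // ltW.
have gl k : (n <= k)%N -> 0 <= gweight alpha k.+2 * x ^+ k.+2 <= 2 / n.+1%:R.
  move=> nk; have /andP[xk0 xk1] := xn k.+2; have gk := gweight_ge0 k.
  rewrite mulr_ge0 //=; apply: le_trans (_ : gweight alpha k.+2 <= _).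
    by rewrite ler_piMr.
  rewrite ler_pdivlMr ?ltr0n // mulrC; apply: le_trans (gweight_le k).
  by apply: ler_wpM2r; [exact: gk | rewrite ler_nat; exact: leqW].
have := gl n (leqnn n); have := gl n.+1 (leqnSn n).
rewrite (gweight_psumS n.+2) (gweight_psumS n.+1).
have -> : 6 / n.+1%:R = 3 * (2 / n.+1%:R) :> R by ring.
move: (gweight_psum _ _) (_ `^ _) (_ * x ^+ n.+3) (_ * x ^+ n.+2) (2 / _) => P Q a b e.
move=> /andP[a0 ae] /andP[b0 be] PQ.
case: mu_bounds => /andP[m10 m12]; rewrite !ler_norml.
move=> /andP[m00 m01] /andP[mm0 mm1] ms.
set c := mu_1 alpha * z + mu_0 alpha + mu_m1 alpha * x.
have c0 : 0 <= c by rewrite /c; nra.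
(* As the signs of [mu_0] and [mu_m1] vary with alpha, all partial sums are expressed through the
   longest one, whose total coefficient [c] is nonnegative. The corrections add up to at most 2 a +
   b <= 3 e. *)
have -> : mu_1 alpha * z * (P + b + a) + mu_0 alpha * (P + b) + mu_m1 alpha * x * P =
  c * (P + b + a) + (- mu_0 alpha) * a + (- (mu_m1 alpha * x)) * (a + b).
  rewrite /c; ring.
have : 0 <= (mu_0 alpha + 1) * a by rewrite mulr_ge0 //; lra.
have : 0 <= (mu_m1 alpha * x + 1) * (a + b).
  have -> : mu_m1 alpha * x + 1 = (mu_m1 alpha + 1) * x + (1 - x) by ring.
  apply: mulr_ge0; last exact: addr_ge0.
  apply: addr_ge0; last by rewrite subr_ge0.
  by apply: mulr_ge0; [lra | exact: ltW].
have : c * (P + b + a) <= c * Q by rewrite ler_wpM2l.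
lra.
Qed.

End Weights.

(** * Bounds on the discrete operators *)

Lemma le_of_harmonic_le (R : realType) (A B S c : R) (n0 : nat) : 0 <= S -> 0 <= c ->
  (forall n, (n0 <= n)%N -> A <= (B + c / n.+1%:R) * S) -> A <= B * S.
Proof.
move=> S0 c0 H; apply/ler_addgt0Pr => e e0.
have Sc : 0 <= c * S / e by rewrite divr_ge0 ?mulr_ge0 // ltW.
pose n := (n0 + Num.bound (c * S / e))%N.
apply: le_trans (H n (leq_addr _ _)) _.
rewrite mulrDl lerD2l mulrAC ler_pdivrMr ?ltr0n // -ler_pdivrMl // mulrC.
by apply: le_trans (ltW (archi_boundP Sc)) _; rewrite ler_nat leqW // leq_addl.
Qed.

Section TemperedForms.
Variables (R : realType) (alpha : R).
Hypothesis (halpha : 1 < alpha < 2).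

Lemma Bop_formE (lambda h : R) M V : V 0%N = 0 -> (forall j, (M <= j)%N -> V j = 0) ->
  \sum_(1 <= i < M) V i * Bop lambda h V i =
  2 / 3 * lag_sum M V 0
  + (expR (lambda * h) + expR (- (lambda * h))) / 6 * lag_sum M V 1.
Proof.
move=> V0 Vout.
have e0 := lag_sum_skip0 M V0 0; have e1 := lag_sum_skip0 M V0 1.
have e2 := lag_sum_pred Vout.
rewrite /Bop; move: (expR (lambda * h)) (expR (- _)) => z x.
transitivity (z / 6 * (\sum_(1 <= i < M) V i * V (i - 1)%N) +
  2 / 3 * (\sum_(1 <= i < M) V i * V (i + 0)%N)
  + x / 6 * (\sum_(1 <= i < M) V i * V (i + 1)%N)); last first.
  by rewrite e0 e1 e2; ring.
rewrite !mulr_sumr -!big_split /=; apply: eq_bigr => i _; rewrite addn0; ring.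
Qed.

(** The form does not depend on the order n at which the row sums are cut, provided n exceeds M;
    letting n tend to infinity removes the defect 6 / (n + 1). *)
Lemma wweight_form_le (lambda h d : R) M V :
  V 0%N = 0 -> (forall j, (M <= j)%N -> V j = 0) -> 0 <= lambda * h ->
  let w := wweight alpha lambda h in
  let x := expR (- (lambda * h)) in
  0 <= w 0%N + w 2 - d -> 0 <= w 0%N + w 2 - d + 4 * w 3 ->
  \sum_(1 <= i < M) V i * (\sum_(0 <= k < (M - i + 1).+1) w k * V (i + k - 1)%N)
    - d * lag_sum M V 1
  <= ((mu_1 alpha * expR (lambda * h) + mu_0 alpha + mu_m1 alpha * x)
      * (1 - x) `^ alpha - d) * lag_sum M V 0.
Proof.
move=> V0 Vout s0 w x d1 d2.
apply: (@le_of_harmonic_le _ _ _ _ 6 M) => [||n Mn] //; first exact: lag_sum0_ge0.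
have w4 k : (3 < k)%N -> 0 <= w k.
  by case: k => [|[|[|[|k]]]] // _; apply: wweight_ge0.
apply: le_trans (toeplitz_form_le V0 Vout (n := n.+4) _ _ w4 d1 d2) _; [lia|lia|].
apply: ler_wpM2r; first exact: lag_sum0_ge0.
rewrite addrAC lerD2r; exact: sum_wweight_le.
Qed.

Lemma wweight_tempered (lambda h : R) k :
  wweight alpha lambda h k = wweight alpha 0 h k * expR ((1 - k%:R) * lambda * h).
Proof.
case: k => [|[|k]] /=.
- by rewrite !mul0r expR0 mulr1 subr0 mul1r.
- by rewrite subrr !mul0r expR0 mulr1.
- by rewrite mulr0 mul0r expR0 mulr1.
Qed.

Lemma wweight_lag0 (lambda h : R) :
  wweight alpha lambda h 0 = mu_1 alpha * expR (lambda * h).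
Proof. by rewrite /wweight gweight0 // mulr1. Qed.

Lemma wweight_lag1 (lambda h : R) :
  wweight alpha lambda h 2 = lag1 alpha * expR (- (lambda * h)).
Proof. by rewrite wweightE2 gweight0 // mulr1 expr1. Qed.

Lemma wweight_lag2 (lambda h : R) :
  wweight alpha lambda h 3 = lag2 alpha * expR (- (lambda * h)) ^+ 2.
Proof. exact: wweightE2. Qed.

(** At lambda = 0 the generating function is evaluated at x = 1, so the bound on the row sums is
    zero. *)
Lemma untempered_form_le0 (h : R) M V :
  V 0%N = 0 -> (forall j, (M <= j)%N -> V j = 0) ->
  \sum_(1 <= i < M) V i
    * (\sum_(0 <= k < (M - i + 1).+1) wweight alpha 0 h k * V (i + k - 1)%N) <= 0.
Proof.
move=> V0 Vout; case: (lag_bounds halpha) => b1 b2 _ _.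
have s0 : 0 <= 0 * h by rewrite mul0r.
have a0 : alpha != 0 by case/andP: halpha => a1 _; rewrite gt_eqF // (lt_trans _ a1).
have := @wweight_form_le 0 h 0 M V V0 Vout s0; cbv zeta.
rewrite wweight_lag0 wweight_lag1 wweight_lag2 !mul0r !oppr0 !expR0.
rewrite subrr powR0 // mulr0 !addr0 expr1n !mulr1 mul0r.
by apply; exact: ltW.
Qed.

(* The row sums cancel up to O(lambda h), relatively to (lambda h)^alpha. *)
Lemma tempered_form_le (lambda h : R) M V :
  V 0%N = 0 -> (forall j, (M <= j)%N -> V j = 0) -> 0 <= lambda -> 0 < h ->
  let s := lambda * h in
  s <= 4^-1 -> 20 * s <= mu_1 alpha + lag1 alpha ->
  20 * s <= mu_1 alpha + lag1 alpha + 4 * lag2 alpha ->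
  \sum_(1 <= i < M) V i * Dop alpha lambda h M V i
    <= 10 * s * lambda `^ alpha * lag_sum M V 0.
Proof.
move=> V0 Vout l0 h0 s s4 b1 b2.
have /andP[a1 a2] := halpha.
have s0 : 0 <= s by rewrite mulr_ge0 // ltW.
case: (lag_bounds halpha) => _ _ /ler_normlP[B1 B2] /ler_normlP[B3 B4].
case: (mu_bounds halpha) => /andP[m10 m12] _ /ler_normlP[B5 B6] ms.
set z := expR s; set x := expR (- s).
have zx : z * x = 1 by exact: expRxMexpNx_1.
have x0 : 0 < x by exact: expR_gt0.
have z0 : 0 < z by exact: expR_gt0.
have xs : 1 - s <= x by exact: expR_ge1Dx.
have zs : 1 + s <= z by exact: expR_ge1Dx.
have x1 : x <= 1 by rewrite /x expR_le1 oppr_le0.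
have z2s : z <= 1 + 2 * s.
  have : z * (1 - s) <= 1 by rewrite -[leRHS]zx ler_wpM2l // ltW.
  clear -s0 s4 z0; nra.
have x2s : x <= 1 - s + s ^+ 2.
  have : x * (1 + s) <= 1 by rewrite mulrC -[leRHS]zx ler_wpM2r // ltW.
  clear -s0 s4 x0; nra.
have h0' := ltW h0.
pose P := s `^ alpha; have P0 : 0 <= P := powR_ge0 _ _.
have PE : P = lambda `^ alpha * h `^ alpha by rewrite /P powRM.
have sE : s * s `^ (alpha - 1) = P by rewrite mulr_powRB1 //; lra.
have s1E : s `^ (alpha - 1) = lambda `^ (alpha - 1) * h `^ (alpha - 1) by rewrite powRM.
have hE : h * h `^ (alpha - 1) = h `^ alpha by rewrite mulr_powRB1 //; lra.
have Ps : P <= s.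
  have [sz|sn0] := eqVneq s 0.
    by rewrite /P sz powR0 // gt_eqF //; lra.
  apply: ge1r_powR; last exact: ltW.
  by rewrite lt_def sn0 s0; lra.
have Q0 : 0 <= s `^ (alpha - 1) := powR_ge0 _ _.
(* The tempered first difference is not skew: its form is (z - x) S_1. This is its coefficient in D,
   up to sign, after multiplication by h^alpha. *)
pose d := alpha * s `^ (alpha - 1) * ((z - x) / 2).
have d0 : d <= 3 * s.
  have : alpha * s `^ (alpha - 1) * ((z - x) / 2) <= alpha * s `^ (alpha - 1) * (3 / 2 * s).
    by apply: ler_wpM2l; [rewrite mulr_ge0 //; lra | lra].
  rewrite -/d => /le_trans; apply.
  have -> : alpha * s `^ (alpha - 1) * (3 / 2 * s) = 3 / 2 * alpha * P by rewrite -sE; ring.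
  clear -Ps P0 a1 a2; nra.
have d1 : alpha * P * (1 - s) <= d.
  have -> : alpha * P * (1 - s) = alpha * s `^ (alpha - 1) * (s * (1 - s)) by rewrite -sE; ring.
  by apply: ler_wpM2l; [rewrite mulr_ge0 //; lra | clear -zs x2s s0; nra].
have H0 : 0 < h `^ (alpha - 1) by rewrite powR_gt0.
have S00 := lag_sum0_ge0 M V.
have S10 := lag_sum_le Vout 1.
have T := @wweight_form_le lambda h d M V V0 Vout s0; cbv zeta in T.
rewrite wweight_lag0 wweight_lag1 wweight_lag2 -/s -/z -/x in T.
(* This and the next sign condition fall below their values at s = 0 by at most 5 s and 13 s, which
   the hypotheses with 20 s absorb. *)
have /T {}T : 0 <= mu_1 alpha * z + lag1 alpha * x - d.
  clear -B1 B2 b1 m10 m12 zs xs x1 d0 s0 x0; nra.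
have /T {}T : 0 <= mu_1 alpha * z + lag1 alpha * x - d + 4 * (lag2 alpha * x ^+ 2).
  clear -B1 B2 B3 B4 b2 m10 m12 zs xs x1 d0 s0 s4 x0.
  have x2 : (1 - s) ^+ 2 <= x ^+ 2 by rewrite ler_sqr ?nnegrE; lra.
  have x21 : x ^+ 2 <= 1 by rewrite expr_le1 // ltW.
  have : lag2 alpha - 2 * s <= lag2 alpha * x ^+ 2 by move: x2 x21; nra.
  nra.
have F := Bop_formE lambda h V0 Vout; rewrite -/s -/z -/x in F.
have -> : \sum_(1 <= i < M) V i * Dop alpha lambda h M V i =
  1 / h `^ alpha * (\sum_(1 <= i < M) V i *
     (\sum_(0 <= k < (M - i + 1).+1) wweight alpha lambda h k * V (i + k - 1)%N)
     - d * lag_sum M V 1)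
  + lambda `^ alpha * (alpha - 1) * \sum_(1 <= i < M) V i * Bop lambda h V i.
  have -> : d * lag_sum M V 1 = \sum_(1 <= i < M)
     alpha * s `^ (alpha - 1) / 2 * (V i * (z * V (i - 1)%N - x * V (i + 1)%N)).
    rewrite -mulr_sumr.
    have -> : \sum_(1 <= i < M) V i * (z * V (i - 1)%N - x * V (i + 1)%N) =
      z * (\sum_(1 <= i < M) V i * V (i - 1)%N) - x * (\sum_(1 <= i < M) V i * V (i + 1)%N).
      by rewrite !mulr_sumr -sumrB; apply: eq_bigr => i _; ring.
    by rewrite (lag_sum_pred Vout) (lag_sum_skip0 M V0) /d; ring.
  rewrite -sumrB !mulr_sumr -big_split /=; apply: eq_bigr => i _.
  rewrite /Dop -/s -/z -/x s1E -hE; field; rewrite !gt_eqF //.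
rewrite F.
(* The cancellation: in units of lambda^alpha the Toeplitz part with the first difference gives 1 -
   alpha + 7 s and the B term (alpha - 1)(1 + s). The sum is (6 + alpha) s, below 10 s. *)
apply: (@le_trans _ _ (1 / h `^ alpha * (P * (1 - alpha + 7 * s) * lag_sum M V 0)
   + lambda `^ alpha * (alpha - 1) * ((1 + s) * lag_sum M V 0))); last first.
  rewrite PE.
  have hp : 0 < h `^ alpha by rewrite powR_gt0.
  have L0 : 0 <= lambda `^ alpha := powR_ge0 _ _.
  have -> : 1 / h `^ alpha * (lambda `^ alpha * h `^ alpha * (1 - alpha + 7 * s) * lag_sum M V 0)
    = lambda `^ alpha * (1 - alpha + 7 * s) * lag_sum M V 0 by field; rewrite gt_eqF.
  have : 0 <= lambda `^ alpha * lag_sum M V 0 by rewrite mulr_ge0.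
  move: (lag_sum M V 0) (lambda `^ alpha) => S L LS; rewrite -subr_ge0.
  rewrite [leRHS](_ : _ = L * S * (s * (4 - alpha))); last by ring.
  by rewrite mulr_ge0 // mulr_ge0 // subr_ge0; lra.
apply: lerD.
  apply: ler_wpM2l; first by rewrite divr_ge0 // powR_ge0.
  apply: le_trans T _; apply: ler_wpM2r => //.
  have xP : (1 - x) `^ alpha <= P.
    by rewrite /P; apply: ge0_ler_powR; rewrite ?nnegrE ?subr_ge0 //; lra.
  set c := mu_1 alpha * z + mu_0 alpha + mu_m1 alpha * x.
  have c0 : 0 <= c by rewrite /c; clear -ms m10 zs s0 B5 B6 x0 x1; nra.
  have c1 : c <= 1 + 5 * s by rewrite /c; clear -ms m10 m12 z2s xs s0 B5 B6 x0 x1; nra.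
  have : c * (1 - x) `^ alpha <= c * P by apply: ler_wpM2l.
  have : c * P <= (1 + 5 * s) * P by apply: ler_wpM2r.
  have : 0 <= (2 - alpha) * (s * P) by rewrite mulr_ge0 ?mulr_ge0 // subr_ge0 ltW.
  lra.
apply: ler_wpM2l; first by rewrite mulr_ge0 ?powR_ge0 //; lra.
clear -S00 S10 z2s x1 x0 z0 s0; nra.
Qed.

End TemperedForms.

(** * Energy estimates *)

Lemma discrete_gronwall (R : realFieldType) (E : nat -> R) (A q : R) N :
  1 <= A -> 0 <= q -> E 0%N <= 0 ->
  (forall n, (n < N)%N -> E n.+1 <= A * (E n + q)) ->
  forall n, (n <= N)%N -> E n <= n%:R * q * A ^+ n.
Proof.
move=> A1 q0 E0 step; elim=> [|n IH] nN; first by rewrite !mul0r.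
have A0 : 0 <= A by lra.
have An : 1 <= A ^+ n by rewrite exprn_ege1.
apply: le_trans (step n nN) _; rewrite exprS mulrCA; apply: ler_wpM2l => //.
rewrite -natr1 !mulrDl mul1r; apply: lerD; first by apply: IH; exact: ltnW.
by rewrite ler_peMr.
Qed.

Section EnergySteps.
Variables (R : realType) (M : nat).
Implicit Types U V : nat -> R.

Definition zero_bdry U := U 0%N = 0 /\ forall j, (M <= j)%N -> U j = 0.

(** The form of the tridiagonal matrix (1/6, 2/3, 1/6), which is B at lambda = 0, written so that
    its symmetry is visible. *)
Definition Bform U V : R := 2 / 3 * (\sum_(0 <= i < M) U i * V i)
  + 1 / 6 * (\sum_(0 <= i < M) (U i * V (i + 1)%N + V i * U (i + 1)%N)).

Lemma BformE h U V : zero_bdry V ->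
  \sum_(1 <= i < M) V i * Bop 0 h U i = Bform U V.
Proof.
move=> [V0 Vout]; rewrite /Bform big_split /=.
rewrite -(sum_pred U (Vout _ (leqnn M))) -(sum_skip0 M U 1 V0).
have -> : \sum_(0 <= i < M) U i * V i = \sum_(1 <= i < M) V i * U i.
  have := sum_skip0 M U 0 V0.
  under eq_bigr do rewrite addn0.
  move=> ->; apply: eq_bigr => i _; by rewrite addn0 mulrC.
rewrite -big_split /= !mulr_sumr -big_split /=; apply: eq_bigr => i _.
rewrite /Bop !mul0r oppr0 expR0; ring.
Qed.

Lemma Bform_bounds V : zero_bdry V ->
  lag_sum M V 0 <= 3 * Bform V V /\ Bform V V <= lag_sum M V 0.
Proof.
move=> [V0 Vout].
have -> : Bform V V = 2 / 3 * lag_sum M V 0 + 1 / 3 * lag_sum M V 1.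
  rewrite /Bform /lag_sum big_split /=; under [in RHS]eq_bigr do rewrite addn0.
  by field.
by have := lag_sum_le Vout 1; have := lag_sum_geN Vout 1; lra.
Qed.

(** Nonnegativity of the form at U - V. *)
Lemma Bform_cauchy U V : zero_bdry U -> zero_bdry V ->
  2 * Bform U V <= Bform U U + Bform V V.
Proof.
move=> [U0 Uout] [V0 Vout].
have W : zero_bdry (fun i => U i - V i).
  by split=> [|j Mj]; rewrite ?U0 ?V0 ?Uout ?Vout // subrr.
have : 0 <= Bform (fun i => U i - V i) (fun i => U i - V i).
  case: (Bform_bounds W) => b _; have := lag_sum0_ge0 M (fun i => U i - V i); lra.
suff -> : Bform (fun i => U i - V i) (fun i => U i - V i) =
  Bform U U + Bform V V - 2 * Bform U V by lra.
rewrite /Bform !mulrDr ![2 * (_ / _ * _)]mulrA !mulr_sumr -!big_split /= -sumrN -!big_split /=.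
apply: eq_bigr => i _; ring.
Qed.

(** Young's inequality; 4 c d >= 1 makes the quadratic form c q^2 - q V + d V^2 nonnegative. *)
Lemma sum_mul_le (c d : R) (q V : nat -> R) : 0 < c -> 1 <= 4 * c * d ->
  \sum_(1 <= i < M) q i * V i
    <= c * (\sum_(1 <= i < M) q i ^+ 2) + d * (\sum_(1 <= i < M) V i ^+ 2).
Proof.
move=> c0 cd; rewrite !mulr_sumr -big_split /=; apply: ler_sum => i _.
rewrite -subr_ge0 -(pmulr_rge0 _ c0).
have : 0 <= (2 * c * q i - V i) ^+ 2 / 4 by rewrite divr_ge0 ?sqr_ge0.
have : 0 <= (4 * c * d - 1) / 4 * V i ^+ 2.
  by rewrite mulr_ge0 ?sqr_ge0 // divr_ge0 // subr_ge0.
lra.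
Qed.

Lemma sum_sqr_lag0 V : V 0%N = 0 -> \sum_(1 <= i < M) V i ^+ 2 = lag_sum M V 0.
Proof.
move=> V0; rewrite -(lag_sum_skip0 M V0 0); apply: eq_bigr => i _.
by rewrite addn0 expr2.
Qed.

Variables (alpha lambda K h tau : R).
Hypotheses (halpha : 1 < alpha < 2) (hlambda : 0 <= lambda) (hK : 0 <= K)
  (hh : 0 < h) (htau : 0 <= tau).

(** The conjugate of [Dop] by the grid function exp(lambda h i); lambda survives only in the
    coefficients lambda^(alpha - 1) and lambda^alpha. *)
Definition untempered_Dop V i : R :=
  1 / h `^ alpha
    * (\sum_(0 <= k < (M - i + 1).+1) wweight alpha 0 h k * V (i + k - 1)%N)
  - alpha * lambda `^ (alpha - 1) / (2 * h) * (V (i - 1)%N - V (i + 1)%N)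
  + lambda `^ alpha * (alpha - 1) * Bop 0 h V i.

(** The equation is tested with [V]: the Toeplitz part is nonpositive, the first difference is skew
    and the B term gives growth. The summand 3 comes from the source, through S_0 <= 3 B(V, V). *)
Lemma untempered_energy_step U V q : zero_bdry U -> zero_bdry V ->
  (forall i, (1 <= i < M)%N ->
    Bop 0 h V i - K * tau * untempered_Dop V i = Bop 0 h U i + tau * q i) ->
  (1 - (2 * K * (lambda `^ alpha * (alpha - 1)) + 3) * tau) * Bform V V
    <= Bform U U + tau * \sum_(1 <= i < M) q i ^+ 2.
Proof.
move=> bU bV H; have [V0 Vout] := bV.
set c := lambda `^ alpha * (alpha - 1).
have E : Bform V V - K * tau * (1 / h `^ alpha *
    (\sum_(1 <= i < M) V i
      * (\sum_(0 <= k < (M - i + 1).+1) wweight alpha 0 h k * V (i + k - 1)%N))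
    + c * Bform V V)
  = Bform U V + tau * \sum_(1 <= i < M) q i * V i.
  rewrite -(BformE h U bV) -(BformE h V bV).
  transitivity (\sum_(1 <= i < M) V i * (Bop 0 h V i - K * tau * untempered_Dop V i)).
    transitivity (\sum_(1 <= i < M) V i * Bop 0 h V i - K * tau * (1 / h `^ alpha *
        (\sum_(1 <= i < M) V i
          * (\sum_(0 <= k < (M - i + 1).+1) wweight alpha 0 h k * V (i + k - 1)%N))
      - alpha * lambda `^ (alpha - 1) / (2 * h) *
        (\sum_(1 <= i < M) V i * V (i - 1)%N - \sum_(1 <= i < M) V i * V (i + 1)%N)
      + c * \sum_(1 <= i < M) V i * Bop 0 h V i)).
      by rewrite (lag_sum_pred Vout) (lag_sum_skip0 M V0) subrr mulr0 subr0.
    rewrite -sumrB !mulr_sumr -sumrB -big_split /= mulr_sumr -sumrB.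
    apply: eq_bigr => i _; rewrite /untempered_Dop -/c; ring.
  rewrite mulr_sumr -big_split /=; apply: eq_big_nat => i iM.
  rewrite (H i iM); ring.
have T := untempered_form_le0 halpha h V0 Vout.
have {}T : 1 / h `^ alpha * (\sum_(1 <= i < M) V i
      * (\sum_(0 <= k < (M - i + 1).+1) wweight alpha 0 h k * V (i + k - 1)%N)) <= 0.
  by apply: mulr_ge0_le0 => //; rewrite divr_ge0 // powR_ge0.
have S := @sum_mul_le 2^-1 2^-1 q V; rewrite (sum_sqr_lag0 V0) in S.
have {}S := S ltac:(by rewrite invr_gt0) ltac:(lra).
have [B1 _] := Bform_bounds bV; have C := Bform_cauchy bU bV.
move: T E; set T := _ * _; move=> T0 E.
have : 0 <= K * tau * - T by rewrite mulr_ge0 ?oppr_ge0 // mulr_ge0.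
have : tau * (\sum_(1 <= i < M) q i * V i)
    <= tau * (2^-1 * (\sum_(1 <= i < M) q i ^+ 2) + 2^-1 * (3 * Bform V V)).
  by apply: ler_wpM2l => //; lra.
lra.
Qed.

(** Testing with [V], the B form is at least S_0 / 4, D takes at most S_0 / 12, and two Young
    inequalities with (6, 1/24) take S_0 / 12 together. The remaining S_0 / 12 gives 72 = 12 * 6
    and, as the squares of B U sum to at most 4 S_0(U), 288 = 72 * 4. *)
Lemma tempered_energy_step U V q : zero_bdry U -> zero_bdry V ->
  let s := lambda * h in
  s <= 4^-1 -> 20 * s <= mu_1 alpha + lag1 alpha ->
  20 * s <= mu_1 alpha + lag1 alpha + 4 * lag2 alpha ->
  120 * (K * tau * lambda `^ alpha * s) <= 1 ->
  (forall i, (1 <= i < M)%N ->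
    Bop lambda h V i - K * tau * Dop alpha lambda h M V i
    = Bop lambda h U i + tau * q i) ->
  lag_sum M V 0 <= 288 * lag_sum M U 0 + 72 * tau ^+ 2 * \sum_(1 <= i < M) q i ^+ 2.
Proof.
move=> bU bV s s4 b1 b2 b3 H.
have [V0 Vout] := bV; have [U0 Uout] := bU.
have T := tempered_form_le halpha V0 Vout hlambda hh s4 b1 b2.
have s0 : 0 <= s by rewrite mulr_ge0 // ltW.
have B := Bop_formE lambda h V0 Vout.
have S0 := lag_sum0_ge0 M V.
have S1 := lag_sum_geN Vout 1.
have E : \sum_(1 <= i < M) V i * Bop lambda h V i
    - K * tau * (\sum_(1 <= i < M) V i * Dop alpha lambda h M V i)
  = \sum_(1 <= i < M) Bop lambda h U i * V i + tau * \sum_(1 <= i < M) q i * V i.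
  rewrite !mulr_sumr -sumrB -big_split /=; apply: eq_big_nat => i iM.
  transitivity (V i * (Bop lambda h V i - K * tau * Dop alpha lambda h M V i)); first by ring.
  rewrite (H i iM); ring.
have Q1 := @sum_mul_le 6 24^-1 (Bop lambda h U) V.
have Q2 := @sum_mul_le 6 24^-1 (fun i => tau * q i) V.
rewrite (sum_sqr_lag0 V0) in Q1; rewrite (sum_sqr_lag0 V0) in Q2.
have {}Q1 := Q1 ltac:(by []) ltac:(lra).
have {}Q2 := Q2 ltac:(by []) ltac:(lra).
have Q2l : \sum_(1 <= i < M) tau * q i * V i = tau * \sum_(1 <= i < M) q i * V i.
  by rewrite mulr_sumr; apply: eq_bigr => i _; rewrite mulrA.
have Q2r : \sum_(1 <= i < M) (tau * q i) ^+ 2 = tau ^+ 2 * \sum_(1 <= i < M) q i ^+ 2.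
  by rewrite mulr_sumr; apply: eq_bigr => i _; rewrite exprMn.
rewrite Q2l Q2r in Q2.
set z := expR s; set x := expR (- s).
have zx : z * x = 1 by exact: expRxMexpNx_1.
have x0 : 0 < x by exact: expR_gt0.
have z0 : 0 < z by exact: expR_gt0.
have xs : 1 - s <= x by exact: expR_ge1Dx.
have x1 : x <= 1 by rewrite /x expR_le1 oppr_le0.
have z43 : z <= 4 / 3.
  have : z * (1 - s) <= 1 by rewrite -[leRHS]zx ler_wpM2l // ltW.
  have : z * (3 / 4) <= z * (1 - s) by apply: ler_wpM2l; [exact: ltW | lra].
  lra.
have QU : \sum_(1 <= i < M) Bop lambda h U i ^+ 2 <= 4 * lag_sum M U 0.
  have P2 : \sum_(1 <= i < M) U (i + 1)%N ^+ 2 <= lag_sum M U 0.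
    apply: le_trans (sum_sqr_shift Uout 1); case: (posnP M) => [->|M0].
      by rewrite !big_geq.
    by rewrite [leRHS]big_ltn // lerDr sqr_ge0.
  have P1 : \sum_(1 <= i < M) U (i - 1)%N ^+ 2 <= lag_sum M U 0.
    apply: le_trans (sum_sqr_shift Uout 0); case: (posnP M) => [->|M0].
      by rewrite !big_geq.
    rewrite -{1}(prednK M0) big_add1 /= -{2}(prednK M0) big_nat_recr //=.
    rewrite -[leLHS]addr0; apply: lerD; last exact: sqr_ge0.
    by apply: ler_sum => k _; rewrite subn1 addn0.
  have P3 := sum_sqr_lag0 U0.
  apply: (@le_trans _ _ (\sum_(1 <= i < M)
     (U (i - 1)%N ^+ 2 + 2 * U i ^+ 2 + U (i + 1)%N ^+ 2))); last first.
    by rewrite !big_split /= -mulr_sumr P3; lra.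
  apply: ler_sum => i _; rewrite /Bop -/s -/z -/x.
  move: (U (i - 1)%N) (U i) (U (i + 1)%N) => u v w.
  have zu : (1 / 6 * z * u) ^+ 2 <= 9^-1 * u ^+ 2.
    rewrite exprMn; apply: ler_wpM2r; first exact: sqr_ge0.
    apply: (@le_trans _ _ (3^-1 ^+ 2)); last by lra.
    by rewrite ler_sqr ?nnegrE; lra.
  have xw : (1 / 6 * x * w) ^+ 2 <= 9^-1 * w ^+ 2.
    rewrite exprMn; apply: ler_wpM2r; first exact: sqr_ge0.
    apply: (@le_trans _ _ (3^-1 ^+ 2)); last by lra.
    by rewrite ler_sqr ?nnegrE; lra.
  move: zu xw; move: (1 / 6 * z * u) (1 / 6 * x * w) => p r zu xw.
  have := sqr_ge0 (p - 2 / 3 * v); have := sqr_ge0 (p - r).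
  have := sqr_ge0 (2 / 3 * v - r); have := sqr_ge0 u; have := sqr_ge0 v.
  have := sqr_ge0 w; lra.
rewrite -/s -/z -/x in B.
(* From S_1 >= - S_0 and z + x <= 7/3: 2/3 - 7/18 exceeds 1/4. *)
have B' : 4^-1 * lag_sum M V 0 <= \sum_(1 <= i < M) V i * Bop lambda h V i.
  rewrite B; move: S1 S0; move: (lag_sum M V 1) (lag_sum M V 0) => a b ab b0.
  have : 0 <= (z + x) * (a + b) by rewrite mulr_ge0 //; lra.
  have : 0 <= (7 / 3 - (z + x)) * b by rewrite mulr_ge0 //; lra.
  lra.
have T' : K * tau * (\sum_(1 <= i < M) V i * Dop alpha lambda h M V i) <= 12^-1 * lag_sum M V 0.
  apply: le_trans (_ : K * tau * (10 * s * lambda `^ alpha * lag_sum M V 0) <= _).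
    by apply: ler_wpM2l => //; rewrite mulr_ge0.
  have -> : K * tau * (10 * s * lambda `^ alpha * lag_sum M V 0) =
    (K * tau * lambda `^ alpha * s) * 10 * lag_sum M V 0 by ring.
  apply: ler_wpM2r => //; lra.
lra.
Qed.

End EnergySteps.

(** * Convergence *)

Lemma eq_Bop (R : realType) (lambda h : R) M (U V : nat -> R) i :
  (1 <= i < M)%N -> (forall j, (j <= M)%N -> U j = V j) ->
  Bop lambda h U i = Bop lambda h V i.
Proof.
by move=> iM UV; rewrite /Bop !UV //; lia.
Qed.

(** Row i reads no index beyond M, so an error extended by zero may replace the raw difference of
    grid functions. *)
Lemma eq_Dop (R : realType) (alpha lambda h : R) M (U V : nat -> R) i :
  (1 <= i < M)%N -> (forall j, (j <= M)%N -> U j = V j) ->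
  Dop alpha lambda h M U i = Dop alpha lambda h M V i.
Proof.
move=> iM UV; rewrite /Dop (eq_Bop _ _ iM UV) !UV; [|lia|lia].
congr (_ * _ - _ + _); apply: eq_big_nat => k kM; rewrite UV //; lia.
Qed.

Lemma BopB (R : realType) (lambda h : R) (U V : nat -> R) i :
  Bop lambda h (fun j => U j - V j) i = Bop lambda h U i - Bop lambda h V i.
Proof. rewrite /Bop; ring. Qed.

Lemma DopB (R : realType) (alpha lambda h : R) M (U V : nat -> R) i :
  Dop alpha lambda h M (fun j => U j - V j) i =
  Dop alpha lambda h M U i - Dop alpha lambda h M V i.
Proof.
rewrite /Dop BopB; under eq_bigr do rewrite mulrBr.
rewrite sumrB; ring.
Qed.

Lemma Bop_exp (R : realType) (lambda h : R) (W : nat -> R) i : (0 < i)%N ->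
  Bop lambda h (fun j => expR (lambda * h * j%:R) * W j) i
  = expR (lambda * h * i%:R) * Bop 0 h W i.
Proof.
case: i => // i _; rewrite /Bop !mul0r oppr0 expR0 subn1 addn1 /=.
rewrite -(natr1 i.+1) -(natr1 i) !mulrDr !mulr1 !expRD.
have := expRxMexpNx_1 (lambda * h).
move: (expR (lambda * h * i%:R)) => y; move: (expR (lambda * h)) (expR (- _)) => z x zx.
apply/eqP; rewrite -subr_eq0 [X in X == 0](_ : _ =
  1 / 6 * (z * x - 1) * (y * z * W i.+2)); last by ring.
by rewrite zx subrr mulr0 mul0r.
Qed.

(** The factor exp((1 - k) lambda h) of w_k turns exp(lambda h (i + k - 1)) into exp(lambda h i).
    For i > 0 the truncated subtraction is exact also at k = 0. *)
Lemma Dop_exp (R : realType) (alpha lambda h : R) M (W : nat -> R) i : (0 < i)%N ->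
  Dop alpha lambda h M (fun j => expR (lambda * h * j%:R) * W j) i
  = expR (lambda * h * i%:R) * untempered_Dop M alpha lambda h W i.
Proof.
move=> i0; rewrite /Dop /untempered_Dop Bop_exp //.
have -> : \sum_(0 <= k < (M - i + 1).+1) wweight alpha lambda h k
      * (expR (lambda * h * (i + k - 1)%:R) * W (i + k - 1)%N)
  = expR (lambda * h * i%:R)
    * \sum_(0 <= k < (M - i + 1).+1) wweight alpha 0 h k * W (i + k - 1)%N.
  rewrite mulr_sumr; apply: eq_bigr => k _; rewrite wweight_tempered.
  have E : expR ((1 - k%:R) * lambda * h) * expR (lambda * h * (i + k - 1)%:R)
      = expR (lambda * h * i%:R).
    rewrite -expRD; congr expR.
    rewrite natrB ?natrD; last by lia.
    ring.
  by rewrite -E; ring.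
case: i i0 => // i _; rewrite (subn1 i.+1) (addn1 i.+1) /=.
rewrite -(natr1 i.+1) -(natr1 i) !mulrDr !mulr1 !expRD.
have := expRxMexpNx_1 (lambda * h).
move: (expR (lambda * h * i%:R)) => y; move: (expR (lambda * h)) (expR (- _)) => z x zx.
apply/eqP; rewrite -subr_eq0 [X in X == 0](_ : _ =
  alpha * lambda `^ (alpha - 1) / (2 * h) * (z * x - 1) * (y * z * W i.+2)); last by ring.
by rewrite zx subrr mulr0 mul0r.
Qed.

Lemma sum_sqr_le (R : realFieldType) M (q : nat -> R) rho :
  (forall i, (1 <= i < M)%N -> `|q i| <= rho) ->
  \sum_(1 <= i < M) q i ^+ 2 <= M%:R * rho ^+ 2.
Proof.
move=> H; apply: (@le_trans _ _ (\sum_(1 <= i < M) rho ^+ 2)).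
  apply: ler_sum_nat => i iM; rewrite -real_normK ?num_real //.
  by have := H i iM; have := normr_ge0 (q i);
    move: `|q i| => y y0 yr; rewrite ler_sqr ?nnegrE //; lra.
rewrite sumr_const_nat -[leLHS]mulr_natl; apply: ler_wpM2r; first exact: sqr_ge0.
by rewrite ler_nat leq_subr.
Qed.

Section Convergence.
Variables (R : realType) (alpha lambda K a b T : R).
Hypotheses (halpha : 1 < alpha < 2) (hlambda : 0 <= lambda) (hK : 0 <= K)
  (hab : a < b) (hT : 0 < T).

Definition error_recursion (M N : nat) (e r : nat -> nat -> R) : Prop :=
  let h := (b - a) / M%:R in
  let tau := T / N%:R in
  [/\ forall n, zero_bdry M (e n), forall i, e 0%N i = 0 &
    forall n i, (n < N)%N -> (1 <= i < M)%N ->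
      Bop lambda h (e n.+1) i - K * tau * Dop alpha lambda h M (e n.+1) i =
      Bop lambda h (e n) i + tau * r n i].

Lemma convergence_small_tau : exists N0 (C : R), 0 <= C /\
  forall M N e r (rho : R), (0 < M)%N -> (0 < N)%N -> (N0 <= N)%N ->
    error_recursion M N e r ->
    (forall n i, (n < N)%N -> (1 <= i < M)%N -> `|r n i| <= rho) ->
    forall n, (n <= N)%N ->
      (b - a) / M%:R * \sum_(1 <= i < M) e n i ^+ 2 <= C * rho ^+ 2.
Proof.
pose g := 2 * K * (lambda `^ alpha * (alpha - 1)) + 3.
have a1 : 0 <= alpha - 1 by case/andP: halpha => a1 _; rewrite subr_ge0 ltW.
have g0 : 0 <= g by rewrite /g addr_ge0 // !mulr_ge0 // powR_ge0.
have ba0 : 0 < b - a by rewrite subr_gt0.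
(* This N0 ensures 2 g tau <= 1. In the constant, the squared exponential undoes the substitution, 3
   passes from the B form to S_0, T exp(2 g T) is Gronwall's factor and b - a is h M. *)
exists (Num.bound (2 * g * T)).
exists (expR (lambda * (b - a)) ^+ 2 * 3 * (T * expR (2 * g * T) * (b - a))).
split; first by rewrite !mulr_ge0 ?exprn_ge0 ?expR_ge0 ?(ltW ba0) ?(ltW hT).
move=> M N e r rho M0 N0 NN [bdry e0 rec] rle n nN.
set h := (b - a) / M%:R in rec *; set tau := T / N%:R in rec *.
have MR : 0 < M%:R :> R by rewrite ltr0n.
have NR : 0 < N%:R :> R by rewrite ltr0n.
have h0 : 0 < h by rewrite divr_gt0.
have tau0 : 0 < tau by rewrite divr_gt0.
have gt : 2 * g * tau <= 1.
  rewrite /tau mulrA ler_pdivrMr // mul1r.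
  apply: le_trans (ltW (archi_boundP _)) _; first by rewrite !mulr_ge0 // ltW.
  by rewrite ler_nat.
pose W n j := expR (- (lambda * h * j%:R)) * e n j.
pose q n i := expR (- (lambda * h * i%:R)) * r n i.
have eW m j : e m j = expR (lambda * h * j%:R) * W m j.
  by rewrite /W mulrA expRxMexpNx_1 mul1r.
have eWf m : e m = (fun j => expR (lambda * h * j%:R) * W m j).
  by apply/funext => j; exact: eW.
have bW m : zero_bdry M (W m).
  by case: (bdry m) => z1 z2; split=> [|j Mj]; rewrite /W ?z1 ?z2 // mulr0.
have lh0 : 0 <= lambda * h by rewrite mulr_ge0 // ltW.
have qle m i : (m < N)%N -> (1 <= i < M)%N -> `|q m i| <= rho.
  move=> mN iM; rewrite /q normrM ger0_norm ?expR_ge0 //.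
  apply: le_trans (rle m i mN iM); rewrite ler_piMl //.
  by rewrite expR_le1 oppr_le0 mulr_ge0.
have recW m i : (m < N)%N -> (1 <= i < M)%N ->
    Bop 0 h (W m.+1) i - K * tau * untempered_Dop M alpha lambda h (W m.+1) i
    = Bop 0 h (W m) i + tau * q m i.
  move=> mN iM; have i0 : (0 < i)%N by case/andP: iM.
  apply: (mulfI (lt0r_neq0 (expR_gt0 (lambda * h * i%:R)))).
  have rE := rec m i mN iM; rewrite (eWf m.+1) (eWf m) !Bop_exp // Dop_exp // in rE.
  have yq : expR (lambda * h * i%:R) * q m i = r m i.
    by rewrite /q mulrA expRxMexpNx_1 mul1r.
  rewrite mulrBr [_ * (K * tau * _)]mulrCA rE -yq; ring.
pose E m := Bform M (W m) (W m).
pose Q := M%:R * rho ^+ 2.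
have Q0 : 0 <= Q by rewrite mulr_ge0 ?sqr_ge0 // ltW.
have stepE m : (m < N)%N -> E m.+1 <= (1 + 2 * g * tau) * (E m + tau * Q).
  move=> mN.
  have S := untempered_energy_step halpha hK (ltW tau0) (bW m) (bW m.+1)
    (fun i iM => recW m i mN iM).
  have S2 : tau * (\sum_(1 <= i < M) q m i ^+ 2) <= tau * Q.
    by apply: ler_wpM2l; [exact: ltW | apply: sum_sqr_le => i; exact: qle].
  have E0 : 0 <= E m.+1.
    have [B1 _] := Bform_bounds (bW m.+1); rewrite /E.
    have := lag_sum0_ge0 M (W m.+1); lra.
  have gt0 : 0 <= g * tau by rewrite mulr_ge0 // ltW.
  have S3 : (1 - g * tau) * E m.+1 <= E m + tau * Q by apply: le_trans S _; rewrite lerD2l.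
  (* With y = g tau, (1 + 2 y)(1 - y) = 1 + y (1 - 2 y) >= 1. *)
  apply: le_trans (_ : (1 + 2 * g * tau) * ((1 - g * tau) * E m.+1) <= _); last first.
    by apply: ler_wpM2l => //; rewrite addr_ge0 // -mulrA mulr_ge0.
  rewrite mulrA ler_peMl //.
  have : 0 <= g * tau * (1 - 2 * g * tau) by rewrite mulr_ge0 // subr_ge0.
  lra.
have En : E n <= n%:R * (tau * Q) * (1 + 2 * g * tau) ^+ n.
  apply: (discrete_gronwall (N := N)) => //.
  - by rewrite lerDl -mulrA !mulr_ge0 // ltW.
  - by rewrite mulr_ge0 // ltW.
  - rewrite /E; have [_ B1] := Bform_bounds (bW 0%N); apply: le_trans B1 _.
    by rewrite /lag_sum big1 // => i _; rewrite /W !e0 mulr0 mul0r.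
have Tn : n%:R * tau <= T.
  by rewrite /tau mulrCA ler_piMr ?(ltW hT) // ler_pdivrMr // mul1r ler_nat.
have En' : E n <= T * Q * expR (2 * g * T).
  apply: le_trans En _; rewrite mulrA; apply: ler_pM.
  - by apply: mulr_ge0 => //; apply: mulr_ge0 => //; exact: ltW.
  - by rewrite exprn_ge0 // addr_ge0 // !mulr_ge0 // ltW.
  - by apply: ler_wpM2r.
  apply: le_trans (_ : expR (2 * g * tau) ^+ n <= _).
    apply: lerXn2r; rewrite ?nnegrE ?expR_ge0 ?expR_ge1Dx //.
    by rewrite addr_ge0 // !mulr_ge0 // ltW.
  rewrite -expRM_natl ler_expR mulrCA; apply: ler_wpM2l => //.
  by rewrite mulr_ge0.
have eE : \sum_(1 <= i < M) e n i ^+ 2 <= expR (lambda * (b - a)) ^+ 2 * (3 * E n).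
  have [B1 _] := Bform_bounds (bW n).
  apply: le_trans (_ : expR (lambda * (b - a)) ^+ 2 * lag_sum M (W n) 0 <= _); last first.
    by apply: ler_wpM2l => //; rewrite sqr_ge0.
  rewrite -(sum_sqr_lag0 M (proj1 (bW n))) mulr_sumr.
  apply: ler_sum_nat => i /andP[i1 iM]; rewrite eW exprMn; apply: ler_wpM2r; first exact: sqr_ge0.
  rewrite ler_sqr ?nnegrE ?expR_ge0 // ler_expR -mulrA; apply: ler_wpM2l => //.
  by rewrite /h -mulrA ler_piMr ?(ltW ba0) // mulrC ler_pdivrMr // mul1r ler_nat ltnW.
have hM : h * M%:R = b - a by rewrite /h mulfVK // gt_eqF.
apply: le_trans (_ : h * (expR (lambda * (b - a)) ^+ 2 * (3 * (T * Q * expR (2 * g * T)))) <= _).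
  apply: ler_wpM2l; first exact: ltW.
  apply: le_trans eE _; apply: ler_wpM2l; first exact: sqr_ge0.
  by apply: ler_wpM2l.
by rewrite le_eqVlt; apply/orP; left; apply/eqP; rewrite -hM /Q; ring.
Qed.

Lemma convergence_small_h (N0 : nat) : exists M0 (C : R), 0 <= C /\
  forall M N e r (rho : R), (0 < M)%N -> (0 < N)%N -> (M0 <= M)%N -> (N <= N0)%N ->
    error_recursion M N e r ->
    (forall n i, (n < N)%N -> (1 <= i < M)%N -> `|r n i| <= rho) ->
    forall n, (n <= N)%N ->
      (b - a) / M%:R * \sum_(1 <= i < M) e n i ^+ 2 <= C * rho ^+ 2.
Proof.
have ba0 : 0 < b - a by rewrite subr_gt0.
case: (lag_bounds halpha) => m1 m2 _ _.
pose G := 1 + K * T * lambda `^ alpha.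
have G0 : 0 <= K * T * lambda `^ alpha.
  by apply: mulr_ge0; [apply: mulr_ge0 => //; exact: ltW | exact: powR_ge0].
(* The four smallness conditions of [tempered_energy_step] on lambda h; the last one uses only tau
   <= T, so the threshold on M is uniform in N. *)
pose d := Num.min (Num.min 4^-1 ((mu_1 alpha + lag1 alpha) / 20))
  (Num.min ((mu_1 alpha + lag1 alpha + 4 * lag2 alpha) / 20) ((120 * G)^-1)).
have d0 : 0 < d.
  by rewrite !lt_min !divr_gt0 //= ?invr_gt0 ?mulr_gt0 //; rewrite /G; lra.
exists (Num.bound (lambda * (b - a) / d)).
exists (N0%:R * T ^+ 2 * 288 ^+ N0 * (b - a)).
split; first by rewrite !mulr_ge0 ?exprn_ge0 ?(ltW ba0) ?(ltW hT).
move=> M N e r rho M0 N1 MM NN [bdry e0 rec] rle n nN.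
set h := (b - a) / M%:R in rec *; set tau := T / N%:R in rec *.
have MR : 0 < M%:R :> R by rewrite ltr0n.
have NR : 0 < N%:R :> R by rewrite ltr0n.
have h0 : 0 < h by rewrite divr_gt0.
have tau0 : 0 < tau by rewrite divr_gt0.
have tauT : tau <= T by rewrite /tau ler_pdivrMr // ler_peMr ?(ltW hT) // ler1n.
pose s := lambda * h.
have s0 : 0 <= s by apply: mulr_ge0 => //; exact: ltW.
have sd : s <= d.
  rewrite /s /h mulrA ler_pdivrMr // [leRHS]mulrC -ler_pdivrMr //.
  apply: le_trans (ltW (archi_boundP _)) _; last by rewrite ler_nat.
  by rewrite divr_ge0 ?mulr_ge0 // ltW.
move: sd; rewrite !le_min => /andP[/andP[s4 sm1] /andP[sm2 sG]].
have b1 : 20 * s <= mu_1 alpha + lag1 alpha by lra.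
have b2 : 20 * s <= mu_1 alpha + lag1 alpha + 4 * lag2 alpha by lra.
have G1 : 0 < 120 * G by rewrite /G; lra.
have b3 : 120 * (K * tau * lambda `^ alpha * s) <= 1.
  have : s * (120 * G) <= 1 by rewrite -ler_pdivlMr // mul1r.
  have : K * tau * lambda `^ alpha * s <= K * T * lambda `^ alpha * s.
    apply: ler_wpM2r => //; apply: ler_wpM2r; first exact: powR_ge0.
    exact: ler_wpM2l.
  rewrite /G; lra.
pose E m := lag_sum M (e m) 0.
pose Q := M%:R * rho ^+ 2.
have Q0 : 0 <= Q by rewrite mulr_ge0 ?sqr_ge0 // ltW.
have TQ0 : 0 <= T ^+ 2 * Q by rewrite mulr_ge0 // sqr_ge0.
have stepE m : (m < N)%N -> E m.+1 <= 288 * (E m + T ^+ 2 * Q).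
  move=> mN.
  apply: le_trans (tempered_energy_step halpha hlambda hK h0 (ltW tau0) (bdry m)
    (bdry m.+1) s4 b1 b2 b3 (fun i iM => rec m i mN iM)) _.
  rewrite -/(E m) mulrDr lerD2l.
  apply: le_trans (_ : 72 * (tau ^+ 2 * Q) <= _).
    rewrite -mulrA; apply: ler_wpM2l => //; apply: ler_wpM2l; first exact: sqr_ge0.
    by apply: sum_sqr_le => i; exact: rle.
  have : tau ^+ 2 * Q <= T ^+ 2 * Q.
    by apply: ler_wpM2r => //; rewrite ler_sqr ?nnegrE // ltW.
  lra.
have En : E n <= n%:R * (T ^+ 2 * Q) * 288 ^+ n.
  apply: (discrete_gronwall (N := N)) => //; first by lra.
  by rewrite /E /lag_sum big1 // => i _; rewrite !e0 mul0r.
have En' : E n <= N0%:R * (T ^+ 2 * Q) * 288 ^+ N0.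
  have nN0 : (n <= N0)%N by exact: leq_trans nN NN.
  apply: le_trans En _; apply: ler_pM.
  - exact: mulr_ge0.
  - exact: exprn_ge0.
  - by apply: ler_wpM2r => //; rewrite ler_nat.
  - by rewrite ler_weXn2l //; lra.
have hM : h * M%:R = b - a by rewrite /h mulfVK // gt_eqF.
rewrite (sum_sqr_lag0 M (proj1 (bdry n))) -/(E n).
apply: le_trans (_ : h * (N0%:R * (T ^+ 2 * Q) * 288 ^+ N0) <= _).
  by apply: ler_wpM2l; [exact: ltW | exact: En'].
by rewrite le_eqVlt; apply/orP; left; apply/eqP; rewrite -hM /Q; ring.
Qed.

(** * From the scheme to the error recursion *)

Variables (f : R -> R -> R) (u0 ua : R -> R) (u : R -> R -> R).
Hypothesis (hu : sufficiently_regular alpha lambda K a b T f u0 ua u).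

Definition grid_error M N (U : nat -> nat -> R) n i : R :=
  restrict_grid a b T M N u n i - U n i.

(** The residual [r] is defined by solving the recursion for it; subtracting the scheme then shows
    that it is the truncation error of [u], to which the regularity bound applies. *)
Lemma scheme_error_recursion : exists C2 : R, 0 <= C2 /\
  forall M N U, (0 < M)%N -> (0 < N)%N ->
    solves_scheme alpha lambda K a b T f u0 ua M N U ->
    exists e r : nat -> nat -> R,
    [/\ error_recursion M N e r,
      forall n i, (n < N)%N -> (1 <= i < M)%N ->
        `|r n i| <= C2 * (T / N%:R + ((b - a) / M%:R) ^+ 3)
    & forall n i, (1 <= i < M)%N -> e n i = grid_error M N U n i].
Proof using hab hT hu.
have [[[_ _ _ ux0 ubd] _] [C2 trunc]] := hu.
have ba0 : 0 < b - a by rewrite subr_gt0.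
exists `|C2|; split=> // M N U M0 N0 [sch U0 Ubd].
have MR : 0 < M%:R :> R by rewrite ltr0n.
have NR : 0 < N%:R :> R by rewrite ltr0n.
set h := (b - a) / M%:R in sch *; set tau := T / N%:R in sch *.
have tau0 : 0 < tau by rewrite divr_gt0.
have h0 : 0 < h by rewrite divr_gt0.
(* Beyond M the grid functions carry arbitrary values. At i = 0 and i = M the error vanishes by the
   boundary conditions, for n <= N. *)
pose e n i := if (0 < i < M)%N then grid_error M N U n i else 0.
have tgridP n : (n <= N)%N -> 0 <= tgrid T N n <= T.
  move=> nN; rewrite /tgrid mulr_ge0 ?(ltW tau0) //=.
  by rewrite mulrCA ler_piMr ?(ltW hT) // ler_pdivrMr // mul1r ler_nat.
have xM : xgrid a b M M = b by rewrite /xgrid mulrCA mulfV ?gt_eqF //; ring.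
have x0 : xgrid a b M 0 = a by rewrite /xgrid mul0r addr0.
have eE n i : (n <= N)%N -> (i <= M)%N -> e n i = grid_error M N U n i.
  move=> nN iM; rewrite /e; case: ifP => // /negbT.
  have [ua_ ub_] := ubd _ (tgridP n nN); have [Ua Ub] := Ubd n nN.
  rewrite negb_and -leqNgt -leqNgt => /orP[i0|Mi]; rewrite /grid_error /restrict_grid.
    by move: i0; rewrite leqn0 => /eqP ->; rewrite x0 ua_ Ua subrr.
  have -> : i = M by apply/anti_leq; rewrite iM Mi.
  by rewrite xM ub_ Ub subrr.
pose r n i := (Bop lambda h (e n.+1) i - K * tau * Dop alpha lambda h M (e n.+1) i
  - Bop lambda h (e n) i) / tau.
exists e, r; split; last by move=> n i iM; rewrite /e iM.
- split.
  + move=> n; split; first by rewrite /e ltnn.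
    by move=> j Mj; rewrite /e [(j < M)%N]ltnNge Mj andbF.
  + move=> i; rewrite /e; case: ifP => // /andP[i0 iM].
    rewrite /grid_error /restrict_grid U0 ?(ltnW iM) // /tgrid mul0r ux0 ?subrr //.
    rewrite /xgrid lerDl mulr_ge0 ?(ltW h0) //= -lerBrDl mulrCA ler_piMr ?(ltW ba0) //.
    by rewrite ler_pdivrMr // mul1r ler_nat ltnW.
  + move=> n i nN iM; rewrite -/h -/tau /r [tau * _]mulrC mulfVK ?gt_eqF //; ring.
move=> n i nN iM.
apply: (@le_trans _ _ (C2 * (tau + h ^+ 3))); last first.
  apply: ler_wpM2r; last exact: ler_norm.
  by rewrite addr_ge0 ?exprn_ge0 // ltW.
have iM' : (1 <= i <= M - 1)%N.
  by have /andP[-> iM''] := iM; rewrite leq_subRL // add1n.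
apply: (trunc M N n i M0 N0 iM' nN); rewrite /is_truncation_error -/h -/tau.
have Ei m j : (m <= N)%N -> (j <= M)%N ->
   e m j = (fun j => restrict_grid a b T M N u m j - U m j) j by exact: eE.
have E1 := eq_Bop lambda h iM (fun j => Ei n.+1 j nN).
have E2 := eq_Bop lambda h iM (fun j => Ei n j (ltnW nN)).
have E3 := eq_Dop alpha lambda h iM (fun j => Ei n.+1 j nN).
rewrite BopB in E1; rewrite BopB in E2; rewrite DopB in E3.
have S := sch n i nN iM'.
rewrite /r E1 E2 E3 mulrC [_ * tau^-1]mulrC mulVKf ?gt_eqF //.
by rewrite mulrBr; lra.
Qed.

(** Uniqueness makes the error norms the same for every solution, so their sum over the time levels,
    divided by tau + h^3 > 0, serves as the constant. If the scheme has no unique solution, the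
    bound is vacuous. *)
Lemma scheme_error_single_grid M N : (0 < M)%N -> (0 < N)%N ->
  exists C : R, 0 <= C /\ forall U,
    is_scheme_solution alpha lambda K a b T f u0 ua M N U ->
    forall n, (n <= N)%N ->
      grid_norm ((b - a) / M%:R) M (grid_error M N U n)
      <= C * (T / N%:R + ((b - a) / M%:R) ^+ 3).
Proof.
move=> M0 N0.
have ba0 : 0 < b - a by rewrite subr_gt0.
set h := (b - a) / M%:R; set tau := T / N%:R.
have th0 : 0 < tau + h ^+ 3 by rewrite addr_gt0 ?exprn_gt0 ?divr_gt0 ?ltr0n.
have [[U0 [U0s U0u]]|noU] := pselect (exists U,
    is_scheme_solution alpha lambda K a b T f u0 ua M N U); last first.
  by exists 0; split=> // U sU; case: noU; exists U.
pose F n := grid_norm h M (grid_error M N U0 n).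
have F0 n : 0 <= F n by exact: sqrtr_ge0.
exists ((\sum_(n < N.+1) F n) / (tau + h ^+ 3)); split.
  by rewrite divr_ge0 ?(ltW th0) // sumr_ge0.
move=> U [Us _] n nN; rewrite divfK ?gt_eqF //.
have -> : grid_norm h M (grid_error M N U n) = F n.
  congr (Num.sqrt (_ * _)); apply: eq_big_nat => i /andP[_ iM].
  by rewrite /grid_error (U0u U Us n i nN (ltnW iM)).
have nN' : (n < N.+1)%N by [].
rewrite (bigD1 (Ordinal nN')) //= lerDl; exact: sumr_ge0.
Qed.

End Convergence.

Theorem theorem3p5 (R : realType) (alpha lambda K a b T : R)
    (f : R -> R -> R) (u0 ua : R -> R) (u : R -> R -> R)
    (halpha : 1 < alpha < 2) (hlambda : 0 <= lambda) (hK : 0 <= K)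
    (hab : a < b) (hT : 0 < T)
    (hu : sufficiently_regular alpha lambda K a b T f u0 ua u) :
  exists C : R, forall (M N : nat) (U : nat -> nat -> R),
    (0 < M)%N -> (0 < N)%N ->
    is_scheme_solution alpha lambda K a b T f u0 ua M N U ->
    forall n : nat, (1 <= n <= N)%N ->
      let h := (b - a) / M%:R in
      let tau := T / N%:R in
      grid_norm h M (fun i => restrict_grid a b T M N u n i - U n i)
        <= C * (tau + h ^+ 3).
Proof.
have [N0 [C1 [C10 H1]]] := convergence_small_tau halpha hlambda hK hab hT.
have [M0 [C2 [C20 H2]]] := convergence_small_h halpha hlambda hK hab hT N0.
have [c [c0 Hc]] := scheme_error_recursion hab hT hu.
(* Choice turns the single-grid constants into a function, which can be summed over the finitely
   many remaining grids. *)
have [D HD] : exists D : nat -> nat -> R, forall M N, 0 <= D M N /\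
    ((0 < M)%N -> (0 < N)%N -> forall U,
    is_scheme_solution alpha lambda K a b T f u0 ua M N U ->
    forall n, (n <= N)%N ->
      grid_norm ((b - a) / M%:R) M (grid_error a b T u M N U n)
      <= D M N * (T / N%:R + ((b - a) / M%:R) ^+ 3)).
  pose P (p : nat * nat) C := 0 <= C /\ ((0 < p.1)%N -> (0 < p.2)%N -> forall U,
    is_scheme_solution alpha lambda K a b T f u0 ua p.1 p.2 U ->
    forall n, (n <= p.2)%N ->
      grid_norm ((b - a) / p.1%:R) p.1 (grid_error a b T u p.1 p.2 U n)
      <= C * (T / p.2%:R + ((b - a) / p.1%:R) ^+ 3)).
  suff /choice[D HD] : forall p, exists C, P p C.
    by exists (fun M N => D (M, N)) => M N; exact: HD (M, N).
  move=> [M N]; rewrite /P /=.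
  case: (posnP M) => [->|Mp]; first by exists 0.
  case: (posnP N) => [->|Np]; first by exists 0.
  have [C [Cp HC]] := scheme_error_single_grid alpha lambda K hab hT f u0 ua u Mp Np.
  by exists C.
pose S := \sum_(M < M0) \sum_(N < N0) D M N.
have D0 M N : 0 <= D M N by case: (HD M N).
have S0 : 0 <= S by apply: sumr_ge0 => M _; apply: sumr_ge0.
(* One summand for each of the three ranges of (M, N); all are nonnegative, so each range may
   discard the other two. *)
exists (Num.sqrt C1 * c + Num.sqrt C2 * c + S) => M N U Mp Np sU n /andP[_ nN].
cbv zeta; set h := (b - a) / M%:R; set tau := T / N%:R.
have th0 : 0 <= tau + h ^+ 3.
  by rewrite addr_ge0 ?exprn_ge0 ?divr_ge0 ?ler0n ?subr_ge0 // ltW.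
rewrite !mulrDl; set rho := tau + h ^+ 3 in th0 *.
have sqrt_bound C e : 0 <= C -> (forall i, (1 <= i < M)%N -> e i = grid_error a b T u M N U n i) ->
    h * \sum_(1 <= i < M) e i ^+ 2 <= C * (c * rho) ^+ 2 ->
    grid_norm h M (fun i => restrict_grid a b T M N u n i - U n i)
    <= Num.sqrt C * c * rho.
  move=> Cp eE le; rewrite -mulrA -[c * rho]ger0_norm ?mulr_ge0 //.
  rewrite -sqrtr_sqr -sqrtrM //; apply: ler_wsqrtr; apply: le_trans le.
  by rewrite le_eqVlt; apply/orP; left; apply/eqP; congr (_ * _);
    apply: eq_big_nat => i /eE ->.
have [e [r [er rle eE]]] := Hc M N U Mp Np sU.1.
have s1 : 0 <= Num.sqrt C1 * c * rho by rewrite !mulr_ge0 ?sqrtr_ge0.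
have s2 : 0 <= Num.sqrt C2 * c * rho by rewrite !mulr_ge0 ?sqrtr_ge0.
have s3 : 0 <= S * rho by rewrite mulr_ge0.
have [NN|NN] := leqP N0 N.
  have := sqrt_bound C1 (e n) C10 (eE n) (H1 M N e r _ Mp Np NN er rle n nN).
  lra.
have [MM|MM] := leqP M0 M.
  have := sqrt_bound C2 (e n) C20 (eE n) (H2 M N e r _ Mp Np MM (ltnW NN) er rle n nN).
  lra.
have [_ /(_ Mp Np U sU n nN)] := HD M N.
rewrite -/h -/tau -/rho => le3.
have : D M N * rho <= S * rho.
  apply: ler_wpM2r => //; rewrite /S (bigD1 (Ordinal MM)) //= (bigD1 (Ordinal NN)) //=.
  rewrite -addrA lerDl addr_ge0 //; first exact: sumr_ge0.
  by apply: sumr_ge0 => i _; apply: sumr_ge0.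
rewrite /grid_error in le3; lra.
Qed.
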